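(* Let $\alpha>0$ and $1\le p\le\infty$. Let $\varphi(z)=a+\lambda z$ where $a,\lambda\in\mathbb{C}$, $|\lambda|<1$ and $\lambda$ is not real, and let $\psi$ be of the form $\psi(z)=e^{a_0+a_1z+a_2z^2}$ with $a_0,a_1,a_2\in\mathbb{C}$. Suppose that the weighted composition operator $W_{\psi,\varphi}f=\psi\cdot(f\circ\varphi)$ is bounded on $\mathcal{F}^p_\alpha$. Then $W_{\psi,\varphi}^2$ is a compact weighted composition operator on $\mathcal{F}^p_\alpha$.
   Context: For $\alpha>0$ and $1\le p<\infty$, the Fock space $\mathcal{F}^p_\alpha$ is the Banach space of entire functions $f:\mathbb{C}\to\mathbb{C}$ with finite norm $\|f\|=\left(\frac{\alpha p}{2\pi}\int_{\mathbb{C}}|f(z)|^p e^{-\frac{\alpha p}{2}|z|^2}\,dm(z)\right)^{1/p}$, where $dm$ is area measure on $\mathbb{C}$. The space $\mathcal{F}^\infty_\alpha$ consists of the entire functions with finite norm $\|f\|=\sup_{z\in\mathbb{C}}|f(z)|e^{-\frac{\alpha}{2}|z|^2}$. A weighted composition operator on $\mathcal{F}^p_\alpha$ is an operator of the form $f\mapsto\widetilde\psi\cdot(f\circ\widetilde\varphi)$ with $\widetilde\psi,\widetilde\varphi$ entire functions, $\widetilde\psi$ not identically zero. It is bounded (compact) on $\mathcal{F}^p_\alpha$ if it maps $\mathcal{F}^p_\alpha$ into itself and is a bounded (compact) linear operator there. $W_{\psi,\varphi}^2$ denotes the composition of $W_{\psi,\varphi}$ with itself. *)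

(* Defs.v *)
From HB Require Import structures.
From mathcomp Require Import all_boot all_order all_algebra.
From mathcomp Require Import complex.
From mathcomp Require Import all_classical all_reals all_analysis.

Set Implicit Arguments.
Unset Strict Implicit.
Unset Printing Implicit Defensive.

Import Order.TTheory GRing.Theory Num.Theory.
Import numFieldNormedType.Exports.

Local Open Scope classical_set_scope.
Local Open Scope ring_scope.
Local Open Scope complex_scope.

Section Fock.
Context {R : realType}.
Local Notation C := R[i].

(* The modulus as an element of R: the norm `|z| of R[i] is R[i]-valued. *)
Definition cmod (z : C) : R := complex.Re `|z|.

Definition cexp (z : C) : C :=
  (expR (complex.Re z) * cos (complex.Im z)) +i*
  (expR (complex.Re z) * sin (complex.Im z)).

(* R[i]^o carries the topology and the normed module structure of the field
   R[i], so derivability in the direction 1 is complex differentiability. *)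
Definition entire (f : C -> C) : Prop :=
  forall z : C, derivable (f : C^o -> C^o) (z : C^o) (1 : C^o).

(* C is identified with R * R, on which area measure is the product of two
   copies of Lebesgue measure. *)
Definition area_integral (g : C -> \bar R) : \bar R :=
  (\int[(@lebesgue_measure R \x @lebesgue_measure R)%E]_u g (u.1 +i* u.2))%E.

(* Only meaningful for 1 <= p; the value +oo means that f is not in the
   space. *)
Definition fock_norm (alpha : R) (p : \bar R) (f : C -> C) : \bar R :=
  match p with
  | r%:E =>
      (((alpha * r / (2 * pi))%:E *
        area_integral (fun z =>
          (cmod (f z) `^ r * expR (- (alpha * r / 2 * cmod z ^+ 2)))%:E))
       `^ r^-1)%E
  | +oo%E =>
      ereal_sup
        (range (fun z => (cmod (f z) * expR (- (alpha / 2 * cmod z ^+ 2)))%:E))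
  | -oo%E => 0%E
  end.

Definition fock (alpha : R) (p : \bar R) : set (C -> C) :=
  [set f | entire f /\ (fock_norm alpha p f < +oo)%E].

Definition weighted_composition (psi phi : C -> C) (f : C -> C) : C -> C :=
  fun z => psi z * f (phi z).

(* An operator on the Fock space is given by a map on all functions, of which
   only the restriction to the space is relevant. *)
Definition linear_operator_on (alpha : R) (p : \bar R)
    (T : (C -> C) -> (C -> C)) : Prop :=
  (forall f, fock alpha p f -> fock alpha p (T f)) /\
  (forall (c : C) (f g : C -> C), fock alpha p f -> fock alpha p g ->
     T (fun z => c * f z + g z) = (fun z => c * T f z + T g z)).

Definition bounded_operator_on (alpha : R) (p : \bar R)
    (T : (C -> C) -> (C -> C)) : Prop :=
  linear_operator_on alpha p T /\
  exists M : R, forall f, fock alpha p f ->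
    (fock_norm alpha p (T f) <= M%:E * fock_norm alpha p f)%E.

(* Every norm-bounded sequence is mapped to a sequence that has a subsequence
   converging in norm to an element of the space. *)
Definition compact_operator_on (alpha : R) (p : \bar R)
    (T : (C -> C) -> (C -> C)) : Prop :=
  linear_operator_on alpha p T /\
  forall f : nat -> C -> C,
    (forall n, fock alpha p (f n)) ->
    (exists M : R, forall n, (fock_norm alpha p (f n) <= M%:E)%E) ->
    exists (s : nat -> nat) (g : C -> C),
      [/\ {homo s : m n / (m < n)%N >-> (m < n)%N},
          fock alpha p g &
          fock_norm alpha p (fun z => T (f (s n)) z - g z) @[n --> \oo]
            --> 0%E].

Definition weighted_composition_operator_on (alpha : R) (p : \bar R)
    (T : (C -> C) -> (C -> C)) : Prop :=
  exists psi phi : C -> C,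
    [/\ entire psi, entire phi, exists z, psi z != 0 &
        forall f, fock alpha p f -> T f = weighted_composition psi phi f].

End Fock.

(* Main.v *)
Require Import Defs.
From mathcomp Require Import all_boot all_order all_algebra.
From mathcomp Require Import complex ring lra.
From mathcomp Require Import all_classical all_reals all_analysis measurable_realfun.

(* On a Gaussian f = exp (c z^2) with |c| close to alpha / 2 and a well-chosen
   argument, W f has quadratic coefficient of modulus |a2| + |c| |lambda|^2;
   since W f grows no faster than exp (alpha |z|^2 / 2) up to lower-order terms
   in the exponent, 2 |a2| <= alpha (1 - |lambda|^2).  The quadratic coefficient
   of the symbol of W^2 is a2 (1 + lambda^2), and |1 + lambda^2| < 1 + |lambda|^2
   for nonreal lambda, so this bound leaves room: W^2 maps a norm-bounded
   sequence to functions dominated by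
   D exp (alpha |z|^2 / 2 - delta |z|^2) with delta > 0.  By Montel's theorem a
   subsequence converges locally uniformly to an entire function, and the
   Gaussian factor exp (- delta |z|^2) turns this into norm convergence.

   Entire functions are only assumed to be pointwise complex differentiable:
   Goursat's theorem on rectangles gives Cauchy's formula, and this a
   second-order Taylor bound that is uniform over locally bounded families and
   therefore makes their pointwise limits entire. *)

Set Implicit Arguments.
Unset Strict Implicit.
Unset Printing Implicit Defensive.

Import Order.TTheory GRing.Theory Num.Theory.
Import numFieldNormedType.Exports.

Local Open Scope classical_set_scope.
Local Open Scope ring_scope.
Local Open Scope complex_scope.

(** * Complex differentiability *)

Section ComplexModulus.
Context {R : realType}.
Local Notation C := R[i].
Local Notation Re := (@complex.Re R).
Local Notation Im := (@complex.Im R).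
Implicit Types (z w : C) (x y : R).

(** Only quadratic coefficients in exponents matter. Whatever [p] is, a norm bound gives [cmod (f z)
    <= A * expR (alpha / 2 * (cmod z + 3) ^+ 2)]. The shift by 3 and the translation in [phi] affect
    only linear and constant terms, which any positive gap between quadratic coefficients absorbs. A
    crude pointwise bound obtained from rectangles therefore suffices, and one argument serves
    finite and infinite [p]. When [2 * cmod a2 = alpha * (1 - cmod lambda ^+ 2)], this estimate
    leaves no gap for a single application of W. In W^2 the coefficients [a2] and [a2 * lambda ^+ 2]
    are added, and since [lambda ^+ 2] is not a nonnegative real their phases differ; the resulting
    cancellation creates the gap. Contour integrals are kept real: only their real part is formed.
    Cauchy's formula then sees only the imaginary part of f, and multiplying f by ['i] or by another
    unimodular constant recovers the rest. *)

Lemma norm_cmod z : `|z| = (cmod z)%:C.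
Proof. by []. Qed.

Lemma cmodE z : cmod z = Num.sqrt (Re z ^+ 2 + Im z ^+ 2).
Proof. by rewrite /cmod normc_def. Qed.

Lemma cmod_ge0 z : 0 <= cmod z.
Proof. by rewrite cmodE sqrtr_ge0. Qed.

Lemma sqr_cmod z : cmod z ^+ 2 = Re z ^+ 2 + Im z ^+ 2.
Proof. by rewrite cmodE sqr_sqrtr// addr_ge0 ?sqr_ge0. Qed.

Lemma cmodM z w : cmod (z * w) = cmod z * cmod w.
Proof. by apply: complexI; rewrite rmorphM /= -!norm_cmod normrM. Qed.

Lemma cmodX z n : cmod (z ^+ n) = cmod z ^+ n.
Proof. by apply: complexI; rewrite rmorphXn /= -!norm_cmod normrX. Qed.

Lemma cmodN z : cmod (- z) = cmod z.
Proof. by apply: complexI; rewrite -!norm_cmod normrN. Qed.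

Lemma cmodV z : cmod z^-1 = (cmod z)^-1.
Proof. by apply: complexI; rewrite fmorphV /= -!norm_cmod normfV. Qed.

Lemma cmodB z w : cmod (z - w) = cmod (w - z).
Proof. by rewrite -cmodN opprB. Qed.

Lemma ler_cmodD z w : cmod (z + w) <= cmod z + cmod w.
Proof. by rewrite -lecR rmorphD /= -!norm_cmod ler_normD. Qed.

Lemma ler_cmodB z w : cmod (z - w) <= cmod z + cmod w.
Proof. by rewrite (le_trans (ler_cmodD _ _))// cmodN. Qed.

Lemma ler_cmodBB z w : cmod z - cmod w <= cmod (z - w).
Proof. by rewrite lerBlDr -[z in leLHS](subrK w) ler_cmodD. Qed.

Lemma cmod_real x : cmod x%:C = `|x|.
Proof. by rewrite cmodE /= expr0n addr0 sqrtr_sqr. Qed.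

Lemma cmod0 : cmod (0 : C) = 0.
Proof. by rewrite (cmod_real 0) normr0. Qed.

Lemma cmod1 : cmod (1 : C) = 1.
Proof. by rewrite (cmod_real 1) normr1. Qed.

Lemma cmodi : cmod ('i : C) = 1.
Proof. by rewrite cmodE /= expr0n add0r expr1n sqrtr1. Qed.

Lemma cmod_eq0 z : (cmod z == 0) = (z == 0).
Proof. by rewrite -[RHS]normr_eq0 norm_cmod (inj_eq (@complexI R)). Qed.

Lemma cmod_gt0 z : (0 < cmod z) = (z != 0).
Proof. by rewrite lt0r cmod_eq0 cmod_ge0 andbT. Qed.

Lemma ler_Re_cmod z : `|Re z| <= cmod z.
Proof. by rewrite cmodE -sqrtr_sqr ler_wsqrtr// lerDl sqr_ge0. Qed.

Lemma ler_Im_cmod z : `|Im z| <= cmod z.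
Proof. by rewrite cmodE -sqrtr_sqr ler_wsqrtr// lerDr sqr_ge0. Qed.

Lemma ler_cmod_ReIm z : cmod z <= `|Re z| + `|Im z|.
Proof.
rewrite -(ler_pXn2r (_ : 0 < 2)%N) ?nnegrE ?cmod_ge0 ?addr_ge0//.
rewrite sqr_cmod sqrrD !real_normK ?num_real// lerD2r lerDl.
by rewrite mulrn_wge0// mulr_ge0.
Qed.

Lemma cReD z w : Re (z + w) = Re z + Re w.
Proof. by case: z; case: w. Qed.

Lemma cImD z w : Im (z + w) = Im z + Im w.
Proof. by case: z; case: w. Qed.

Lemma cReN z : Re (- z) = - Re z.
Proof. by case: z. Qed.

Lemma cImN z : Im (- z) = - Im z.
Proof. by case: z. Qed.

Lemma cReB z w : Re (z - w) = Re z - Re w.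
Proof. by rewrite cReD cReN. Qed.

Lemma cImB z w : Im (z - w) = Im z - Im w.
Proof. by rewrite cImD cImN. Qed.

Lemma cReM z w : Re (z * w) = Re z * Re w - Im z * Im w.
Proof. by case: z; case: w. Qed.

Lemma cImM z w : Im (z * w) = Re z * Im w + Im z * Re w.
Proof. by case: z; case: w. Qed.

Lemma cmod_cexp z : cmod (cexp z) = expR (Re z).
Proof.
rewrite cmodE /= !exprMn -mulrDr cos2Dsin2 mulr1 sqrtr_sqr.
by rewrite ger0_norm// expR_ge0.
Qed.

Lemma cexpD z w : cexp (z + w) = cexp z * cexp w.
Proof.
apply/eqP; rewrite eq_complex /= cReD cImD expRD cosD sinD.
by apply/andP; split; apply/eqP; ring.
Qed.


(** The difference quotient is multiplied out, so that [h = 0] needs no exception and all estimates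
    are inequalities between reals. *)
Definition cdiff (f : C -> C) z (d : C) := forall e : R, 0 < e ->
  exists2 r : R, 0 < r &
    forall h, cmod h < r -> cmod (f (z + h) - f z - d * h) <= e * cmod h.

(** The order of [R[i]] compares only numbers with equal imaginary parts, so every epsilon of the
    [R[i]]-valued norm is a positive real. *)
Lemma gt0_real (e : C) : 0 < e -> e = (Re e)%:C /\ 0 < Re e.
Proof. by case: e => x y; rewrite ltcE /= => /andP[/eqP->]. Qed.

Lemma derivable_cdiff (f : C -> C) z :
  derivable (f : C^o -> C^o) (z : C^o) (1 : C^o) <-> exists d, cdiff f z d.
Proof.
split.
- move=> /cvg_ex[/= d /cvgrPdist_le/= fd]; exists d => e e0.
  have := fd e%:C; rewrite ltcR => /(_ e0).
  rewrite /dnbhs near_withinE => /nbhs_norm0P[r /gt0_real[-> r0] rP].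
  exists (Re r) => // h hr.
  have [->|h0] := eqVneq h 0; first by rewrite addr0 subrr sub0r mulr0 oppr0 cmod0 mulr0.
  have : `|d - h^-1 *: (f (h *: 1 + z) - f z)| <= e%:C.
    by apply: rP => //=; rewrite norm_cmod ltcR.
  rewrite norm_cmod lecR => {}rP.
  have -> : f (z + h) - f z - d * h = - (d - h^-1 *: (f (h *: 1 + z) - f z)) * h.
    rewrite opprB mulrBl; congr (_ - _).
    by rewrite /GRing.scale/= mulrAC mulVf// mul1r mulr1 (addrC h).
  by rewrite cmodM cmodN ler_wpM2r// cmod_ge0.
- move=> [d fd]; apply/cvg_ex; exists d; apply/cvgrPdist_le => /= eps /gt0_real[-> e0].
  have [r r0 rP] := fd _ e0.
  rewrite /dnbhs near_withinE.
  suff : \forall y \near (0 : C^o),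
    y != 0 -> `|d - y^-1 *: (f (y *: 1 + z) - f z)| <= (Re eps)%:C by [].
  apply/nbhs_norm0P.
  exists r%:C; first by rewrite /= ltcR.
  move=> h /=; rewrite norm_cmod ltcR => hr h0.
  have -> : d - h^-1 *: (f (h *: 1 + z) - f z) = - (f (z + h) - f z - d * h) / h.
    rewrite /GRing.scale/= mulr1 (addrC h) opprB mulrBl mulfK//.
    by congr (_ - _); rewrite mulrC.
  rewrite norm_cmod lecR cmodM cmodN cmodV ler_pdivrMr ?cmod_gt0//.
  exact: rP.
Qed.

Lemma cdiff_comp (f g : C -> C) z d d' :
  cdiff f z d -> cdiff g (f z) d' -> cdiff (g \o f) z (d' * d).
Proof.
move=> fd gd e e0.
(* [M] dominates both [cmod d'] and the local Lipschitz constant [cmod d + 1] of [f], so each of the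
   two error terms below is at most [e1 * M * cmod h <= e / 2 * cmod h]. *)
pose M := cmod d + 1 + cmod d'.
have d0 := cmod_ge0 d; have d'0 := cmod_ge0 d'.
have M0 : 0 < M by rewrite /M; lra.
pose e1 := Num.min 1 (e / (2 * M)).
have e10 : 0 < e1 by rewrite lt_min ltr01 divr_gt0// mulr_gt0.
have [r r0 rP] := fd _ e10; have [s s0 sP] := gd _ e10.
exists (Num.min r (s / M)); first by rewrite lt_min r0 divr_gt0.
move=> h; rewrite lt_min => /andP[hr hs].
have h0 := cmod_ge0 h.
have fh : cmod (f (z + h) - f z) <= M * cmod h.
  have := rP h hr; set A := f (z + h) - f z => Ah.
  have : cmod A <= cmod (A - d * h) + cmod d * cmod h.
    by have := ler_cmodD (A - d * h) (d * h); rewrite subrK cmodM.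
  move=> /le_trans; apply; rewrite /M.
  have : cmod (A - d * h) <= 1 * cmod h.
    by rewrite (le_trans Ah)// ler_wpM2r// ge_min lexx.
  have := mulr_ge0 d'0 h0; nra.
have := sP (f (z + h) - f z); rewrite [f z + _]addrC subrK => H.
have : cmod (f (z + h) - f z) < s.
  by rewrite (le_lt_trans fh)// mulrC -ltr_pdivlMr.
move=> /H{H}; have := rP h hr; set A := f (z + h) - f z => Ah gA.
have -> : (g \o f) (z + h) - (g \o f) z - d' * d * h =
   (g (f (z + h)) - g (f z) - d' * A) + d' * (A - d * h) by rewrite /=; ring.
rewrite (le_trans (ler_cmodD _ _))// cmodM.
have e2 : e1 * M <= e / 2.
  by rewrite -ler_pdivlMr// -mulrA -invfM ge_min lexx orbT.
have := cmod_ge0 (A - d * h); have := cmod_ge0 A.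
move=> A0 B0.
apply: (@le_trans _ _ (e1 * (M * cmod h) + M * (e1 * cmod h))).
  apply: lerD.
    by apply: (le_trans gA); rewrite ler_wpM2l// ltW.
  by apply: ler_pM => //; rewrite /M; lra.
nra.
Qed.

Lemma is_derive_near0 (g : R -> R) (l : R) : is_derive (0 : R) 1 g l ->
  forall e : R, 0 < e -> exists2 r : R, 0 < r &
    forall x, `|x| < r -> `|g x - g 0 - l * x| <= e * `|x|.
Proof.
move=> [gD gl] e e0; move: gD gl => /cvg_ex[/= d gd].
rewrite /derive (cvg_lim _ gd)// => dl; rewrite {}dl in gd.
move/cvgrPdist_le : gd => /(_ _ e0) /=.
rewrite /dnbhs near_withinE => /nbhs_norm0P[r r0 rP].
exists r => // x xr.
have [->|x0] := eqVneq x 0; first by rewrite subrr sub0r mulr0 oppr0 normr0 mulr0.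
have := rP x xr x0; rewrite addr0 [_ *: 1]mulr1 => H.
have -> : g x - g 0 - l * x = - (l - x^-1 *: (g x - g 0)) * x.
  by rewrite opprB mulrBl [x^-1 *: _]mulrC mulfVK.
by rewrite normrM normrN ler_wpM2r.
Qed.

Lemma cdiff_cexp0 : cdiff cexp 0 1.
Proof.
move=> e e0.
(* The real part costs [4 * e1 * cmod h], the imaginary part [e1 * cmod h + 4 * cmod h ^+ 2] with
   [cmod h < e1]: altogether [9 * e1 * cmod h], which 16 covers. *)
pose e1 := Num.min 1 (e / 16).
have e10 : 0 < e1 by rewrite lt_min ltr01 divr_gt0.
have e11 : e1 <= 1 by rewrite ge_min lexx.
have e18 : 16 * e1 <= e by rewrite mulrC -ler_pdivlMr// ge_min lexx orbT.
have [r1 r10 r1P] := is_derive_near0 (is_derive_expR 0) e10.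
have [r2 r20 r2P] := is_derive_near0 (is_derive_sin 0) e10.
have [r3 r30 r3P] := is_derive_near0 (is_derive_cos 0) e10.
exists (Num.min e1 (Num.min r1 (Num.min r2 r3))); first by rewrite lt_min e10 lt_min r10 lt_min r20 r30.
move=> h; rewrite lt_min => /andP[he1]; rewrite !lt_min => /and3P[hr1 hr2 hr3].
have hx := ler_Re_cmod h; have hy := ler_Im_cmod h.
have := r1P _ (le_lt_trans hx hr1); have := r2P _ (le_lt_trans hy hr2).
have := r3P _ (le_lt_trans hy hr3).

rewrite cos0 sin0 expR0 !mul1r subr0 oppr0 mul0r subr0.
set x := Re h in hx *; set y := Im h in hy *.
set c := cos y - 1; set s := sin y - y; set E := expR x - 1 - x => c0 s0 E0.
have rho0 := cmod_ge0 h.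
have [nx ny] : 0 <= `|x| /\ 0 <= `|y| by split.
have cr : `|c| <= e1 * cmod h by rewrite (le_trans c0)// ler_wpM2l// ltW.
have sr : `|s| <= e1 * cmod h by rewrite (le_trans s0)// ler_wpM2l// ltW.
have Er : `|E| <= e1 * cmod h by rewrite (le_trans E0)// ler_wpM2l// ltW.
have E1 : `|E| <= cmod h by rewrite (le_trans Er)// ler_piMl.
have s1 : `|s| <= cmod h by rewrite (le_trans sr)// ler_piMl.
have h1 : cmod h <= 1 by lra.
apply: (le_trans (ler_cmod_ReIm _)); rewrite !(cReB, cImB) add0r /= expR0 cos0 sin0 -/x -/y mulr1 mulr0 subr0.
have -> : expR x * cos y - 1 - x = E + (1 + x + E) * c by rewrite /E /c; ring.
have -> : expR x * sin y - y = s + (x + E) * (y + s) by rewrite /E /s; ring.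
have p1 : `|E + (1 + x + E) * c| <= e1 * cmod h + 3 * (e1 * cmod h).
  rewrite (le_trans (ler_normD _ _))// lerD// normrM ler_pM//.
  rewrite (le_trans (ler_normD _ _))// (le_trans (lerD (ler_normD _ _) (lexx _)))// normr1.
  lra.
have p2 : `|s + (x + E) * (y + s)| <= e1 * cmod h + (2 * cmod h) * (2 * cmod h).
  rewrite (le_trans (ler_normD _ _))// lerD// normrM ler_pM//;
  rewrite (le_trans (ler_normD _ _))//; lra.
apply: (le_trans (lerD p1 p2)); nra.
Qed.

Lemma cdiff_cexp z : cdiff cexp z (cexp z).
Proof.
move=> e e0.
have [|r r0 rP] := cdiff_cexp0 (e := e / cmod (cexp z)).
  by rewrite divr_gt0// cmod_cexp expR_gt0.
exists r => // h /rP; rewrite add0r mul1r.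
have -> : cexp (z + h) - cexp z - cexp z * h = cexp z * (cexp h - cexp 0 - h).
  have -> : cexp (0 : C) = 1 by rewrite /cexp /= expR0 cos0 sin0 mulr1 mulr0.
  by rewrite cexpD; ring.
rewrite cmodM mulrAC ler_pdivlMr ?cmod_cexp ?expR_gt0// => H.
by rewrite mulrC.
Qed.

Lemma cdiff_quadratic (c0 c1 c2 : C) z :
  cdiff (fun w => c0 + c1 * w + c2 * w ^+ 2) z (c1 + 2 * c2 * z).
Proof.
move=> e e0; have c0' := cmod_ge0 c2.
exists (e / (1 + cmod c2)) => [|h]; first by rewrite divr_gt0//; lra.
rewrite ltr_pdivlMr; last lra.
move=> hr; have -> : (c0 + c1 * (z + h) + c2 * (z + h) ^+ 2) -
  (c0 + c1 * z + c2 * z ^+ 2) - (c1 + 2 * c2 * z) * h = c2 * h * h by ring.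
rewrite !cmodM ler_wpM2r ?cmod_ge0//; have := cmod_ge0 h; nra.
Qed.

Lemma entire_cexp_quadratic (c0 c1 c2 : C) :
  entire (fun w => cexp (c0 + c1 * w + c2 * w ^+ 2)).
Proof.
move=> z; apply/derivable_cdiff; eexists.
exact: (cdiff_comp (@cdiff_quadratic c0 c1 c2 z) (@cdiff_cexp _)).
Qed.

Lemma entire_quadratic (c0 c1 c2 : C) :
  entire (fun w => c0 + c1 * w + c2 * w ^+ 2).
Proof.
by move=> z; apply/derivable_cdiff; eexists; apply: cdiff_quadratic.
Qed.

End ComplexModulus.

(** * Goursat's theorem and Cauchy's formula *)

Section SegmentIntegral.
Context {R : realType}.
Implicit Types (a b m k M : R) (g : R -> R).

Definition cts a b g := forall x, a <= x <= b -> {for x, continuous g}.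

Definition intR a b g : R := Rintegral (@lebesgue_measure R) `[a, b]%classic g.

Lemma cts_integrable a b g : cts a b g ->
  (@lebesgue_measure R).-integrable `[a, b]%classic (EFin \o g).
Proof.
move=> gc; apply: continuous_compact_integrable; first exact: segment_compact.
apply: continuous_in_subspaceT => x; rewrite inE /= in_itv /=; exact: gc.
Qed.

Lemma ctsB a b g1 g2 : cts a b g1 -> cts a b g2 -> cts a b (fun x => g1 x - g2 x).
Proof. by move=> c1 c2 x xab; apply: cvgB; [exact: c1|exact: c2]. Qed.

Lemma ctsZ a b k g : cts a b g -> cts a b (fun x => k * g x).
Proof. by move=> c x xab; apply: cvgMr; exact: c. Qed.

Lemma cts_cst a b k : cts a b (fun=> k).
Proof. by move=> x _; exact: cvg_cst. Qed.

Lemma ctsS a b a' b' g : a <= a' -> b' <= b -> cts a b g -> cts a' b' g.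
Proof. by move=> aa bb c x /andP[? ?]; apply: c; lra. Qed.

Lemma intRD a b g1 g2 : cts a b g1 -> cts a b g2 ->
  intR a b (fun x => g1 x + g2 x) = intR a b g1 + intR a b g2.
Proof. by move=> c1 c2; rewrite /intR RintegralD//; exact: cts_integrable. Qed.

Lemma intRB a b g1 g2 : cts a b g1 -> cts a b g2 ->
  intR a b (fun x => g1 x - g2 x) = intR a b g1 - intR a b g2.
Proof. by move=> c1 c2; rewrite /intR RintegralB//; exact: cts_integrable. Qed.

Lemma intRZ a b k g : cts a b g -> intR a b (fun x => k * g x) = k * intR a b g.
Proof. by move=> c; rewrite /intR RintegralZl//; exact: cts_integrable. Qed.

Lemma intR_cst a b k : a <= b -> intR a b (fun=> k) = k * (b - a).
Proof.
move=> ab; rewrite /intR Rintegral_cst//= lebesgue_measure_itv /= lte_fin.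
by case: ltP => // ba; rewrite (_ : b = a) ?subrr//; lra.
Qed.

Lemma eq_intR a b g1 g2 : (forall x, a <= x <= b -> g1 x = g2 x) ->
  intR a b g1 = intR a b g2.
Proof. by move=> g12; apply: eq_Rintegral => x; rewrite inE /= in_itv /= => /g12. Qed.

Lemma le_intR a b g1 g2 : cts a b g1 -> cts a b g2 ->
  (forall x, a <= x <= b -> g1 x <= g2 x) -> intR a b g1 <= intR a b g2.
Proof.
by move=> c1 c2 g12; apply: le_Rintegral => //; exact: cts_integrable.
Qed.

Lemma intR_dist a b k M g : a <= b -> cts a b g ->
  (forall x, a <= x <= b -> `|g x - k| <= M) -> `|intR a b g - k * (b - a)| <= M * (b - a).
Proof.
move=> ab c H; rewrite ler_distl -mulrBl -mulrDl -!intR_cst//; apply/andP.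
split; apply: le_intR => //; try exact: cts_cst.
- by move=> x /H; rewrite ler_distl => /andP[].
- by move=> x /H; rewrite ler_distl => /andP[].
Qed.

Lemma intR_split a m b g : a <= m -> m <= b -> cts a b g ->
  intR a b g = intR a m g + intR m b g.
Proof.
move=> am mb c; apply/eqP; rewrite addrC -subr_eq; apply/eqP.
rewrite /intR (Rintegral_itvB (cts_integrable c))//.
rewrite Rintegral_itv_obnd_cbnd//.
have /integrableS : lebesgue_measure.-integrable `[m, b]%classic (EFin \o g).
  by apply: cts_integrable; apply: ctsS c.
by apply => //; apply: subset_itvr; rewrite bnd_simp.
Qed.

End SegmentIntegral.

Section Goursat.
Context {R : realType}.
Local Notation C := R[i].
Local Notation Re := (@complex.Re R).
Local Notation Im := (@complex.Im R).
Implicit Types (h f : C -> C) (z w d : C).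

Definition ccont h z := forall e : R, 0 < e -> exists2 r : R, 0 < r &
  forall w, cmod (w - z) < r -> cmod (h w - h z) <= e.

Definition cderivable h z := derivable (h : C^o -> C^o) (z : C^o) (1 : C^o).

Lemma cdiff_ccont h z d : cdiff h z d -> ccont h z.
Proof.
move=> /(_ _ ltr01)[r r0 rP] e e0; have d0 := cmod_ge0 d.
exists (Num.min r (e / (1 + cmod d))).
  by rewrite lt_min r0 divr_gt0//; lra.
move=> w; rewrite lt_min => /andP[/rP]; rewrite [z + _]addrC subrK => H.
rewrite ltr_pdivlMr; last lra.
have := ler_cmodD (h w - h z - d * (w - z)) (d * (w - z)).
by rewrite subrK cmodM; nra.
Qed.

Lemma cderivable_ccont h z : cderivable h z -> ccont h z.
Proof. by move=> /derivable_cdiff[d /cdiff_ccont]. Qed.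

Lemma ccont_Re_h h y (x : R) : ccont h (x +i* y) ->
  {for x, continuous (fun t => Re (h (t +i* y)))}.
Proof.
move=> hc; apply/cvgrPdist_le => e /hc[r r0 rP].
near=> t; rewrite -cReB (le_trans (ler_Re_cmod _))// cmodB rP//.
have -> : (t +i* y) - (x +i* y) = (t - x)%:C by apply/eqP; rewrite eq_complex /= subrr !eqxx.
by rewrite cmod_real distrC; near: t; apply: cvgr_dist_lt.
Unshelve. all: by end_near. Qed.

Lemma ccont_Im_v h x (y : R) : ccont h (x +i* y) ->
  {for y, continuous (fun t => Im (h (x +i* t)))}.
Proof.
move=> hc; apply/cvgrPdist_le => e /hc[r r0 rP].
near=> t; rewrite -cImB (le_trans (ler_Im_cmod _))// cmodB rP//.
have -> : (x +i* t) - (x +i* y) = 'i * (t - y)%:C.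
  by apply/eqP; rewrite eq_complex /=; apply/andP; split; apply/eqP; ring.
by rewrite cmodM cmodi mul1r cmod_real distrC; near: t; apply: cvgr_dist_lt.
Unshelve. all: by end_near. Qed.

(* The real part of the integral of h along the positively oriented boundary of
   the rectangle. *)
Definition Re_contour h x1 x2 y1 y2 : R :=
  intR x1 x2 (fun x => Re (h (x +i* y1)) - Re (h (x +i* y2))) -
  intR y1 y2 (fun y => Im (h (x2 +i* y)) - Im (h (x1 +i* y))).

Definition on_rect (P : C -> Prop) x1 x2 y1 y2 :=
  forall x y, x1 <= x <= x2 -> y1 <= y <= y2 -> P (x +i* y).

Lemma on_rectS (P : C -> Prop) x1 x2 y1 y2 x1' x2' y1' y2' :
  x1 <= x1' -> x2' <= x2 -> y1 <= y1' -> y2' <= y2 ->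
  on_rect P x1 x2 y1 y2 -> on_rect P x1' x2' y1' y2'.
Proof. by move=> ? ? ? ? H x y /andP[? ?] /andP[? ?]; apply: H; lra. Qed.

Lemma on_rect_ccont h x1 x2 y1 y2 :
  on_rect (cderivable h) x1 x2 y1 y2 -> on_rect (ccont h) x1 x2 y1 y2.
Proof. by move=> H x y xP yP; apply/cderivable_ccont/H. Qed.

Lemma ctsh h x1 x2 y : on_rect (ccont h) x1 x2 y y ->
  cts x1 x2 (fun x => Re (h (x +i* y))).
Proof. by move=> H x xP; apply: ccont_Re_h; apply: H; rewrite ?lexx. Qed.

Lemma ctsv h y1 y2 x : on_rect (ccont h) x x y1 y2 ->
  cts y1 y2 (fun y => Im (h (x +i* y))).
Proof. by move=> H y yP; apply: ccont_Im_v; apply: H; rewrite ?lexx. Qed.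

(** Continuity is required on the edges and on the cut only, because the integrand may have a pole
    inside the rectangle. *)
Lemma Re_contour_split_x h x1 m x2 y1 y2 : x1 <= m -> m <= x2 -> y1 <= y2 ->
  on_rect (fun w => (Re w \in [:: x1; m; x2]) || (Im w \in [:: y1; y2]) ->
    ccont h w) x1 x2 y1 y2 ->
  Re_contour h x1 x2 y1 y2 = Re_contour h x1 m y1 y2 + Re_contour h m x2 y1 y2.
Proof.
move=> xm mx yy H.
have Hh y : (y == y1) || (y == y2) -> cts x1 x2 (fun x => Re (h (x +i* y))).
  move=> yE; apply: ctsh => u v uP /andP[? ?]; have -> : v = y by lra.
  apply: H => //; last by rewrite /= !inE yE orbT.
  by case/orP: yE => /eqP->; lra.
have Hv x : [|| x == x1, x == m | x == x2] -> cts y1 y2 (fun y => Im (h (x +i* y))).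
  move=> xE; apply: ctsv => u v /andP[? ?] vP; have -> : u = x by lra.
  apply: H => //; last by rewrite /= !inE xE.
  by case/or3P: xE => /eqP->; lra.
rewrite /Re_contour (intR_split xm mx); last by apply: ctsB; apply: Hh; rewrite eqxx ?orbT.
have [c1 cm c2] : [/\ cts y1 y2 (fun y => Im (h (x1 +i* y))),
    cts y1 y2 (fun y => Im (h (m +i* y))) & cts y1 y2 (fun y => Im (h (x2 +i* y)))].
  by split; apply: Hv; rewrite eqxx ?orbT.
by rewrite (intRB c2 c1) (intRB cm c1) (intRB c2 cm); ring.
Qed.

Lemma Re_contour_split_y h x1 x2 y1 m y2 : y1 <= m -> m <= y2 -> x1 <= x2 ->
  on_rect (fun w => (Re w \in [:: x1; x2]) || (Im w \in [:: y1; m; y2]) ->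
    ccont h w) x1 x2 y1 y2 ->
  Re_contour h x1 x2 y1 y2 = Re_contour h x1 x2 y1 m + Re_contour h x1 x2 m y2.
Proof.
move=> ym my xx H.
have Hh y : [|| y == y1, y == m | y == y2] -> cts x1 x2 (fun x => Re (h (x +i* y))).
  move=> yE; apply: ctsh => u v uP /andP[? ?]; have -> : v = y by lra.
  apply: H => //; last by rewrite /= !inE yE orbT.
  by case/or3P: yE => /eqP->; lra.
have Hv x : (x == x1) || (x == x2) -> cts y1 y2 (fun y => Im (h (x +i* y))).
  move=> xE; apply: ctsv => u v /andP[? ?] vP; have -> : u = x by lra.
  apply: H => //; last by rewrite /= !inE xE.
  by case/orP: xE => /eqP->; lra.
rewrite /Re_contour [in intR y1 y2 _](intR_split ym my); last first.
  by apply: ctsB; apply: Hv; rewrite eqxx ?orbT.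
have [c1 cm c2] : [/\ cts x1 x2 (fun x => Re (h (x +i* y1))),
    cts x1 x2 (fun x => Re (h (x +i* m))) & cts x1 x2 (fun x => Re (h (x +i* y2)))].
  by split; apply: Hh; rewrite eqxx ?orbT.
by rewrite (intRB c1 c2) (intRB c1 cm) (intRB cm c2); ring.
Qed.

(** The affine part of [h] contributes [Im d * (x2 - x1) * (y2 - y1)] to each of the two integrals
    in [Re_contour], and these cancel. What remains is the error on the four sides, where the
    distance to the base point is at most [(x2 - x1) + (y2 - y1)]. *)
Lemma Re_contour_local h x1 x2 y1 y2 (x y e r : R) d : 0 < e ->
  x1 <= x <= x2 -> y1 <= y <= y2 -> on_rect (ccont h) x1 x2 y1 y2 ->
  (forall w, cmod w < r -> cmod (h ((x +i* y) + w) - h (x +i* y) - d * w) <= e * cmod w) ->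
  (x2 - x1) + (y2 - y1) < r ->
  `|Re_contour h x1 x2 y1 y2| <= 2 * e * ((x2 - x1) + (y2 - y1)) ^+ 2.
Proof.
move=> e0 /andP[xx xx2] /andP[yy yy2] H dP lr; set z := x +i* y.
set l := (x2 - x1) + (y2 - y1) in lr *.
have err u v : x1 <= u <= x2 -> y1 <= v <= y2 ->
    cmod (h (u +i* v) - h z - d * ((u +i* v) - z)) <= e * l.
  move=> /andP[? ?] /andP[? ?].
  have wl : cmod ((u +i* v) - z) <= l.
    rewrite (le_trans (ler_cmod_ReIm _))//= /l lerD// ler_norml; lra.
  have := dP _ (le_lt_trans wl lr); rewrite [_ + (_ - _)]addrC subrK.
  by move=> /le_trans; apply; rewrite ler_wpM2l// ltW.
have x12 : x1 <= x2 by lra.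
have y12 : y1 <= y2 by lra.
have A1 : `|intR x1 x2 (fun x => Re (h (x +i* y1)) - Re (h (x +i* y2))) -
    Im d * (y2 - y1) * (x2 - x1)| <= 2 * e * l * (x2 - x1).
  apply: intR_dist => //.
    by apply: ctsB; apply: ctsh; apply: on_rectS H.
  move=> u uP.
  have := err u y1 uP; rewrite lexx y12 => /(_ isT)/(le_trans (ler_Re_cmod _)).
  have := err u y2 uP; rewrite lexx y12 => /(_ isT)/(le_trans (ler_Re_cmod _)).
  rewrite !cReB !cReM /=; rewrite !ler_norml; lra.
have A2 : `|intR y1 y2 (fun y => Im (h (x2 +i* y)) - Im (h (x1 +i* y))) -
    Im d * (x2 - x1) * (y2 - y1)| <= 2 * e * l * (y2 - y1).
  apply: intR_dist => //.
    by apply: ctsB; apply: ctsv; apply: on_rectS H.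
  move=> v vP.
  have := err x1 v _ vP; rewrite lexx x12 => /(_ isT)/(le_trans (ler_Im_cmod _)).
  have := err x2 v _ vP; rewrite lexx x12 => /(_ isT)/(le_trans (ler_Im_cmod _)).
  rewrite !cImB !cImM /=; rewrite !ler_norml; lra.
rewrite /Re_contour; move: A1 A2; rewrite /l !ler_norml; lra.
Qed.

End Goursat.

Section GoursatTheorem.
Context {R : realType}.
Local Notation C := R[i].
Local Notation Re := (@complex.Re R).
Local Notation Im := (@complex.Im R).
Implicit Types (h f : C -> C) (z w d : C).

Lemma Re_contour_quarter h x1 x2 y1 y2 : x1 <= x2 -> y1 <= y2 ->
  on_rect (ccont h) x1 x2 y1 y2 ->
  exists x1' x2' y1' y2', [/\ x1 <= x1' /\ x2' <= x2, y1 <= y1' /\ y2' <= y2,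
    x2' - x1' = (x2 - x1) / 2, y2' - y1' = (y2 - y1) / 2 &
    `|Re_contour h x1 x2 y1 y2| <= 4 * `|Re_contour h x1' x2' y1' y2'|].
Proof.
move=> xx yy H; pose m := (x1 + x2) / 2; pose n := (y1 + y2) / 2.
have [xm mx yn ny] : [/\ x1 <= m, m <= x2, y1 <= n & n <= y2].
  by rewrite /m /n; split; lra.
have E : Re_contour h x1 x2 y1 y2 = (Re_contour h x1 m y1 n + Re_contour h x1 m n y2) +
    (Re_contour h m x2 y1 n + Re_contour h m x2 n y2).
  rewrite (Re_contour_split_x xm mx)//; last by move=> x y xP yP _; apply: H.
  by congr (_ + _); rewrite (Re_contour_split_y yn ny)// => x y xP yP _;
    apply: H; lra.
have [h1|h1] := leP `|Re_contour h x1 x2 y1 y2| (4 * `|Re_contour h x1 m y1 n|).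
  by exists x1, m, y1, n; split; rewrite /m /n; try split; lra.
have [h2|h2] := leP `|Re_contour h x1 x2 y1 y2| (4 * `|Re_contour h x1 m n y2|).
  by exists x1, m, n, y2; split; rewrite /m /n; try split; lra.
have [h3|h3] := leP `|Re_contour h x1 x2 y1 y2| (4 * `|Re_contour h m x2 y1 n|).
  by exists m, x2, y1, n; split; rewrite /m /n; try split; lra.
exists m, x2, n, y2; split; rewrite /m /n; try (split; lra); try lra.
rewrite leNgt; apply/negP => h4; move: h1 h2 h3 h4; rewrite -/m -/n.
move: (ler_normD (Re_contour h x1 m y1 n + Re_contour h x1 m n y2) (Re_contour h m x2 y1 n + Re_contour h m x2 n y2)).
rewrite -E.
have := ler_normD (Re_contour h x1 m y1 n) (Re_contour h x1 m n y2).
have := ler_normD (Re_contour h m x2 y1 n) (Re_contour h m x2 n y2).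
lra.
Qed.

(** Bisection: passing to a suitable quarter loses at most a factor 4, while the bound of
    [Re_contour_local] around the common point of the nested rectangles drops by exactly 4. The
    contour is thus at most [2 * e * L ^+ 2] for every [e]. *)
Lemma goursat h x1 x2 y1 y2 : x1 <= x2 -> y1 <= y2 ->
  on_rect (cderivable h) x1 x2 y1 y2 -> Re_contour h x1 x2 y1 y2 = 0.
Proof.
move=> x12 y12 H; have Hc := on_rect_ccont H.
pose T := (R * R * (R * R))%type.
pose P (q : T) := [/\ q.1.1 <= q.1.2, q.2.1 <= q.2.2,
  (x1 <= q.1.1 /\ q.1.2 <= x2) & (y1 <= q.2.1 /\ q.2.2 <= y2)].
pose A (q : T) := `|Re_contour h q.1.1 q.1.2 q.2.1 q.2.2|.
(* Quadruples that are not subrectangles get themselves as a default value, which makes [step] a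
   total function that can be iterated. *)
have /choice[step stepP] : forall q : T, exists s : T, P q ->
    [/\ P s, q.1.1 <= s.1.1 /\ s.1.2 <= q.1.2,
     q.2.1 <= s.2.1 /\ s.2.2 <= q.2.2,
     s.1.2 - s.1.1 = (q.1.2 - q.1.1) / 2 /\ s.2.2 - s.2.1 = (q.2.2 - q.2.1) / 2 &
     A q <= 4 * A s].
  move=> q.
  have [qP|nP] := pselect (P q); last by exists q.
  have [q1 q2 [q3 q4] [q5 q6]] := qP.
  have [|x1' [x2' [y1' [y2' [[? ?] [? ?] ? ? ?]]]]] := @Re_contour_quarter h _ _ _ _ q1 q2.
    by apply: on_rectS Hc.
  by exists ((x1', x2'), (y1', y2')) => _; split => //=; split=> /=; try split; lra.
pose s n := iter n step ((x1, x2), (y1, y2)).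
have sP n : P (s n).
  elim: n => [|n IH]; first by split.
  by have [] := stepP _ IH.
have sS n : [/\ (s n).1.1 <= (s n.+1).1.1, (s n.+1).1.2 <= (s n).1.2,
    (s n).2.1 <= (s n.+1).2.1 & (s n.+1).2.2 <= (s n).2.2].
  by have [_ [? ?] [? ?] _ _] := stepP _ (sP n).
have len n : ((s n).1.2 - (s n).1.1) + ((s n).2.2 - (s n).2.1) =
    ((x2 - x1) + (y2 - y1)) / 2 ^+ n.
  elim: n => [|n IH]; first by rewrite expr0 divr1.
  have [_ _ _ [-> ->] _] := stepP _ (sP n).
  by rewrite -mulrDl IH exprS invfM mulrA mulrAC.
have AS n : A (s 0%N) <= 4 ^+ n * A (s n).
  elim: n => [|n IH]; first by rewrite expr0 mul1r.
  have [_ _ _ _ H4] := stepP _ (sP n).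
  by rewrite (le_trans IH)// exprSr -mulrA ler_wpM2l// exprn_ge0.
have mono (g : nat -> R) : (forall n, g n <= g n.+1) -> {homo g : m n / (m <= n)%N >-> m <= n}.
  by move=> gS; apply: homo_leq => // ? ? ?; exact: le_trans.
have nest (l r : nat -> R) : (forall n, l n <= l n.+1) -> (forall n, r n.+1 <= r n) ->
    (forall n, l n <= r n) -> exists t, forall n, l n <= t <= r n.
  move=> lS rS lr.
  have lrmn m n : l m <= r n.
    have l1 : l m <= l (maxn m n) by apply: mono => //; rewrite leq_maxl.
    have r1 : - r n <= - r (maxn m n).
      by apply: (mono (fun n => - r n)) => [k|]; rewrite ?lerN2 ?leq_maxr.
    by have := lr (maxn m n); lra.
  have sup_l : has_sup (range l).
    by split; [exists (l 0%N), 0%N|exists (r 0%N) => _ [m _ <-]].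
  exists (sup (range l)) => n; apply/andP; split.
    by apply: ub_le_sup; [case: sup_l|exists n].
  by apply: ge_sup; [case: sup_l|move=> _ [m _ <-]].
have [x xP] : exists t, forall n, (s n).1.1 <= t <= (s n).1.2.
  by apply: nest => n; [case: (sS n)|case: (sS n)|case: (sP n)].
have [y yP] : exists t, forall n, (s n).2.1 <= t <= (s n).2.2.
  by apply: nest => n; [case: (sS n)|case: (sS n)|case: (sP n)].
have [d dP] : exists d, cdiff h (x +i* y) d.
  by apply/derivable_cdiff; apply: H; [exact: (xP 0%N)|exact: (yP 0%N)].
set L := (x2 - x1) + (y2 - y1) in len.
have L0 : 0 <= L by rewrite /L; lra.
suff small (e : R) : 0 < e -> A (s 0%N) <= 2 * e * L ^+ 2.
  apply/eqP; rewrite -normr_eq0 eq_le normr_ge0 andbT -[X in X <= _]/(A (s 0%N)).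
  apply/ler_addgt0Pr => e e0; rewrite add0r.
  have e'0 : 0 < e / (2 * (1 + L ^+ 2)) by rewrite divr_gt0// mulr_gt0// ltr_wpDr ?sqr_ge0.
  apply: (le_trans (small _ e'0)).
  rewrite invfM [_ * (_^-1 * _)]mulrA [2 * _]mulrA [2 * _]mulrC divfK//.
  rewrite mulrAC ler_pdivrMr ?ltr_wpDr ?sqr_ge0//.
  by rewrite ler_pM2l// lerDr.
move=> e0; have [r r0 rP] := dP _ e0.
have [n nP] : exists n, L / 2 ^+ n < r.
  pose n := (Num.truncn (L / r)).+1; exists n.
  rewrite ltr_pdivrMr ?exprn_gt0// mulrC -ltr_pdivrMr//.
  have : L / r < n%:R by rewrite truncnS_gt.
  move=> /lt_le_trans; apply; rewrite -natrX ler_nat ltnW//.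
  exact: ltn_expl.
apply: (le_trans (AS n)).
have [a1 a2 [a3 a4] [a5 a6]] := sP n.
have Hn : on_rect (ccont h) (s n).1.1 (s n).1.2 (s n).2.1 (s n).2.2.
  by apply: on_rectS Hc.
have lr : ((s n).1.2 - (s n).1.1) + ((s n).2.2 - (s n).2.1) < r by rewrite len.
have := Re_contour_local e0 (xP n) (yP n) Hn rP lr.
rewrite len -/(A (s n)) => /(ler_wpM2l (exprn_ge0 n (ler0n R 4))) /le_trans; apply.
rewrite [leLHS](_ : _ = 2 * e * L ^+ 2)//.
rewrite expr_div_n -exprM mulnC exprM (_ : 2 ^+ 2 = 4 :> R); last by rewrite -natrX.
field.
by rewrite expf_neq0.
Qed.

End GoursatTheorem.

(** * Cauchy's formula on rectangles *)

Section CauchyFormula.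
Context {R : realType}.
Local Notation C := R[i].
Local Notation Re := (@complex.Re R).
Local Notation Im := (@complex.Im R).
Implicit Types (h f : C -> C) (z w d k : C).

Definition on_bdry (P : C -> Prop) x1 x2 y1 y2 :=
  on_rect (fun w => (Re w \in [:: x1; x2]) || (Im w \in [:: y1; y2]) -> P w) x1 x2 y1 y2.

Lemma on_bdry_imp (P Q : C -> Prop) x1 x2 y1 y2 : (forall w, P w -> Q w) ->
  on_bdry P x1 x2 y1 y2 -> on_bdry Q x1 x2 y1 y2.
Proof. by move=> PQ H x y xP yP B; apply: PQ; apply: H. Qed.

Section Boundary.
Variables (x1 x2 y1 y2 : R).
Hypotheses (x12 : x1 <= x2) (y12 : y1 <= y2).
Local Notation on_bdry P := (on_bdry P x1 x2 y1 y2).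
Local Notation bdry_Re_contour h := (Re_contour h x1 x2 y1 y2).

Lemma on_bdryP (P : C -> Prop) : on_bdry P ->
  [/\ forall x, x1 <= x <= x2 -> P (x +i* y1),
      forall x, x1 <= x <= x2 -> P (x +i* y2),
      forall y, y1 <= y <= y2 -> P (x1 +i* y) &
      forall y, y1 <= y <= y2 -> P (x2 +i* y)].
Proof.
by move=> H; split=> t tP; apply: H; rewrite ?lexx ?x12 ?y12//= !inE eqxx ?orbT.
Qed.

Lemma on_bdry_cts h : on_bdry (ccont h) ->
  [/\ cts x1 x2 (fun x => Re (h (x +i* y1))),
      cts x1 x2 (fun x => Re (h (x +i* y2))),
      cts y1 y2 (fun y => Im (h (x1 +i* y))) &
      cts y1 y2 (fun y => Im (h (x2 +i* y)))].
Proof.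
by move=> /on_bdryP[a b c d]; split => t tP;
  do ?[exact/ccont_Re_h/a|exact/ccont_Re_h/b|exact/ccont_Im_v/c|exact/ccont_Im_v/d].
Qed.

Lemma eq_ReC h1 h2 : on_bdry (fun w => h1 w = h2 w) -> bdry_Re_contour h1 = bdry_Re_contour h2.
Proof.
move=> /on_bdryP[a b c d]; rewrite /Re_contour; congr (_ - _); apply: eq_intR => t tP.
  by rewrite a// b.
by rewrite c// d.
Qed.

Lemma Re_contourD h1 h2 : on_bdry (ccont h1) -> on_bdry (ccont h2) ->
  bdry_Re_contour (fun w => h1 w + h2 w) = bdry_Re_contour h1 + bdry_Re_contour h2.
Proof.
move=> /on_bdry_cts[a b c d] /on_bdry_cts[a' b' c' d']; rewrite /Re_contour.
rewrite (@eq_intR _ _ _ _ (fun x => (Re (h1 (x +i* y1)) - Re (h1 (x +i* y2))) +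
  (Re (h2 (x +i* y1)) - Re (h2 (x +i* y2))))); last first.
  by move=> x _; rewrite !cReD; ring.
rewrite (@eq_intR _ y1 _ _ (fun y => (Im (h1 (x2 +i* y)) - Im (h1 (x1 +i* y))) +
  (Im (h2 (x2 +i* y)) - Im (h2 (x1 +i* y))))); last first.
  by move=> y _; rewrite !cImD; ring.
by rewrite (intRD (ctsB a b) (ctsB a' b')) (intRD (ctsB d c) (ctsB d' c')); ring.
Qed.

Lemma Re_contourZ (k : R) h : on_bdry (ccont h) -> bdry_Re_contour (fun w => k%:C * h w) = k * bdry_Re_contour h.
Proof.
move=> /on_bdry_cts[a b c d]; rewrite /Re_contour.
rewrite (@eq_intR _ _ _ _ (fun x => k * (Re (h (x +i* y1)) - Re (h (x +i* y2))))); last first.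
  by move=> x _; rewrite !cReM /=; ring.
rewrite (@eq_intR _ y1 _ _ (fun y => k * (Im (h (x2 +i* y)) - Im (h (x1 +i* y))))); last first.
  by move=> y _; rewrite !cImM /=; ring.
by rewrite (intRZ k (ctsB a b)) (intRZ k (ctsB d c)); ring.
Qed.

Lemma Re_contour_cst k : bdry_Re_contour (fun=> k) = 0.
Proof. by rewrite /Re_contour !subrr !intR_cst//; ring. Qed.

(** The majorant may vary along the sides: a constant one gives Cauchy estimates, while [cmod (f w)]
    bounds a value of an entire [f] by integrals of its modulus. *)
Lemma Re_contour_le h (G : C -> R) : on_bdry (ccont h) -> on_bdry (fun w => cmod (h w) <= G w) ->
  cts x1 x2 (fun x => G (x +i* y1)) -> cts x1 x2 (fun x => G (x +i* y2)) ->
  cts y1 y2 (fun y => G (x1 +i* y)) -> cts y1 y2 (fun y => G (x2 +i* y)) ->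
  `|bdry_Re_contour h| <= intR x1 x2 (fun x => G (x +i* y1)) + intR x1 x2 (fun x => G (x +i* y2)) +
    (intR y1 y2 (fun y => G (x1 +i* y)) + intR y1 y2 (fun y => G (x2 +i* y))).
Proof.
move=> /on_bdry_cts[a b c d] /on_bdryP[ga gb gc gd] Ga Gb Gc Gd; rewrite /Re_contour.
rewrite (intRB a b) (intRB d c).
have side (s t : R) (g F : R -> R) : cts s t g -> cts s t F -> (forall x, s <= x <= t -> `|g x| <= F x) ->
    `|intR s t g| <= intR s t F.
  move=> cg cF gF; rewrite ler_norml; apply/andP; split.
    rewrite -mulN1r -intRZ//; apply: le_intR => //; first exact: ctsZ.
    by move=> x /gF; rewrite ler_norml mulN1r => /andP[].
  by apply: le_intR => // x /gF; rewrite ler_norml => /andP[].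
have /= := side _ _ _ _ a Ga (fun x xP => le_trans (ler_Re_cmod _) (ga x xP)).
have /= := side _ _ _ _ b Gb (fun x xP => le_trans (ler_Re_cmod _) (gb x xP)).
have /= := side _ _ _ _ c Gc (fun x xP => le_trans (ler_Im_cmod _) (gc x xP)).
have /= := side _ _ _ _ d Gd (fun x xP => le_trans (ler_Im_cmod _) (gd x xP)).
by rewrite !ler_norml; lra.
Qed.

Lemma Re_contour_bound h (M : R) : on_bdry (ccont h) -> on_bdry (fun w => cmod (h w) <= M) ->
  `|bdry_Re_contour h| <= 2 * M * ((x2 - x1) + (y2 - y1)).
Proof.
move=> hc hM; have := @Re_contour_le h (fun=> M) hc hM.
rewrite !intR_cst// => H; apply: le_trans (H _ _ _ _) _; try exact: cts_cst.
by lra.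
Qed.

End Boundary.

(** The strips to the left and right of the inner rectangle, then those below and above it, avoid
    the pole, so Goursat's theorem removes them. *)
Lemma Re_contour_shrink h (x y x1 x2 y1 y2 x1' x2' y1' y2' : R) :
  x1 <= x1' < x -> x < x2' <= x2 -> y1 <= y1' < y -> y < y2' <= y2 ->
  (forall w, w != x +i* y -> cderivable h w) ->
  Re_contour h x1 x2 y1 y2 = Re_contour h x1' x2' y1' y2'.
Proof.
move=> /andP[X1 X1'] /andP[X2' X2] /andP[Y1 Y1'] /andP[Y2' Y2] hD.
have D u v : (u != x) || (v != y) -> cderivable h (u +i* v).
  by move=> uv; apply: hD; rewrite eq_complex /= negb_and.
have Dc u v : (u != x) || (v != y) -> ccont h (u +i* v).
  by move=> /D/cderivable_ccont.
rewrite (@Re_contour_split_x _ _ _ x1') ?(@Re_contour_split_x _ _ x1' x2' x2)//; try lra; last 2 first.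
- move=> u v uP vP; rewrite /= !inE => uv; apply: Dc; rewrite -negb_and; apply/negP.
  by move: uv => /orP[/or3P[]|/orP[]] /eqP-> /andP[/eqP? /eqP?]; lra.
- move=> u v uP vP; rewrite /= !inE => uv; apply: Dc; rewrite -negb_and; apply/negP.
  by move: uv => /orP[/or3P[]|/orP[]] /eqP-> /andP[/eqP? /eqP?]; lra.
rewrite [X in X + (_ + _)]goursat ?[X in _ + (_ + X)]goursat; try lra; last 2 first.
- by move=> u v uP vP; apply: D; apply/orP; left; apply/eqP; lra.
- by move=> u v uP vP; apply: D; apply/orP; left; apply/eqP; lra.
rewrite add0r addr0.
rewrite (@Re_contour_split_y _ _ _ _ _ y1') ?(@Re_contour_split_y _ _ _ _ y1' y2' y2)//; try lra; last 2 first.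
- move=> u v uP vP; rewrite /= !inE => uv; apply: Dc; rewrite -negb_and; apply/negP.
  by move: uv => /orP[/orP[]|/or3P[]] /eqP-> /andP[/eqP? /eqP?]; lra.
- move=> u v uP vP; rewrite /= !inE => uv; apply: Dc; rewrite -negb_and; apply/negP.
  by move: uv => /orP[/orP[]|/or3P[]] /eqP-> /andP[/eqP? /eqP?]; lra.
rewrite [X in X + (_ + _)]goursat ?[X in _ + (_ + X)]goursat; try lra; last 2 first.
- by move=> u v uP vP; apply: D; apply/orP; right; apply/eqP; lra.
- by move=> u v uP vP; apply: D; apply/orP; right; apply/eqP; lra.
Qed.

Lemma continuous_cauchy_density (x : R) : continuous (fun t => (1 + (t - x) ^+ 2)^-1).
Proof.
move=> t; apply: cvgV; first by rewrite gt_eqF// ltr_wpDr// sqr_ge0.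
apply: cvgD; first exact: cvg_cst.
by apply: cvgM; apply: cvgB; [exact: cvg_id|exact: cvg_cst|exact: cvg_id|exact: cvg_cst].
Qed.

Lemma intR_atan (x : R) : intR (x - 1) (x + 1) (fun t => (1 + (t - x) ^+ 2)^-1) = pi / 2.
Proof.
have D (t : R) : is_derive t 1 (fun t : R => atan (t - x)) (1 + (t - x) ^+ 2)^-1.
  have : is_derive (t : R) 1 (fun t : R => t - x) 1.
    by apply: is_derive_eq; rewrite subr0.
  move=> H; have := @is_derive1_comp R atan (fun t => t - x) t _ _ (is_derive1_atan (t - x)) H.
  by rewrite mulr1.
have cont (t : R) : {for t, continuous (fun t : R => atan (t - x))}.
  apply: differentiable_continuous; apply/derivable1_diffP.
  by case: (D t).
rewrite /intR /Rintegral (@continuous_FTC2 _ _ (fun t : R => atan (t - x))); first last.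
- by move=> t _; rewrite derive1E; case: (D t).
- split.
  + by move=> t _; case: (D t).
  + exact: cvg_at_right_filter (cont _).
  + exact: cvg_at_left_filter (cont _).
- by apply: continuous_subspaceT => t; exact: continuous_cauchy_density.
- lra.
rewrite /= addrAC subrr add0r addrAC subrr add0r atanN atan1; lra.
Qed.

(** This is the real part of [2 pi i k]. On the square of half-side 1 the kernels on opposite sides
    combine to [2 i k / (1 + s^2)] and [2 k / (1 + s^2)], [s] being the offset from the midpoint of
    the side, so the arctangent evaluates both integrals. *)
Lemma Re_contour_residue k (x y : R) :
  Re_contour (fun w => k / (w - (x +i* y))) (x - 1) (x + 1) (y - 1) (y + 1) = - (2 * pi) * Im k.
Proof.
have cinv (a b : R) : (a +i* b)^-1 = (a / (a ^+ 2 + b ^+ 2)) -i* (b / (a ^+ 2 + b ^+ 2)).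
  by [].
have pos (t : R) : 1 + t ^+ 2 != 0 by rewrite gt_eqF// ltr_wpDr// sqr_ge0.
rewrite /Re_contour.
rewrite (@eq_intR _ _ _ _ (fun t => (-2 * Im k) * (1 + (t - x) ^+ 2)^-1)); last first.
  move=> t _; have -> : (t +i* (y - 1)) - (x +i* y) = (t - x) -i* 1.
    by apply/eqP; rewrite eq_complex /=; apply/andP; split; apply/eqP; ring.
  have -> : (t +i* (y + 1)) - (x +i* y) = (t - x) +i* 1.
    by apply/eqP; rewrite eq_complex /=; apply/andP; split; apply/eqP; ring.
  rewrite !cinv !cReM /= !sqrrN !expr1n [_ + 1]addrC; field.
  exact: pos.
rewrite (@eq_intR _ (y - 1) _ _ (fun t => (2 * Im k) * (1 + (t - y) ^+ 2)^-1)); last first.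
  move=> t _; have -> : ((x + 1) +i* t) - (x +i* y) = 1 +i* (t - y).
    by apply/eqP; rewrite eq_complex /=; apply/andP; split; apply/eqP; ring.
  have -> : ((x - 1) +i* t) - (x +i* y) = (-1) +i* (t - y).
    by apply/eqP; rewrite eq_complex /=; apply/andP; split; apply/eqP; ring.
  rewrite !cinv !cImM /= !sqrrN !expr1n; field.
  exact: pos.
have ctsi (u a b : R) : cts a b (fun t => (1 + (t - u) ^+ 2)^-1).
  by move=> t _; exact: continuous_cauchy_density.
by rewrite !intRZ// !intR_atan; field.
Qed.

End CauchyFormula.

(** * Cauchy's formula for entire functions and second-order Taylor estimates *)

Section CauchyEstimates.
Context {R : realType}.
Local Notation C := R[i].
Local Notation Re := (@complex.Re R).
Local Notation Im := (@complex.Im R).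
Implicit Types (f g : C -> C) (h z w d k : C).

Lemma cderivableM f g z : cderivable f z -> cderivable g z ->
  cderivable (fun w => f w * g w) z.
Proof. by move=> fz hz; exact: (derivableM fz hz). Qed.

Lemma cderivableB f g z : cderivable f z -> cderivable g z ->
  cderivable (fun w => f w - g w) z.
Proof. by move=> fz hz; exact: (derivableB fz hz). Qed.

Lemma cderivableV f z : f z != 0 -> cderivable f z -> cderivable (fun w => (f w)^-1) z.
Proof. by move=> fz0 fz; exact: (derivableV fz0 fz). Qed.

Lemma cderivable_cst k z : cderivable (fun=> k) z.
Proof. exact: derivable_cst. Qed.

Lemma cderivable_id z : cderivable id z.
Proof. exact: derivable_id. Qed.

Lemma cderivable_pole z w : w != z -> cderivable (fun w => (w - z)^-1) w.
Proof.
move=> wz; apply: (@cderivableV (fun w => w - z)); first by rewrite subr_eq0.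
by apply: cderivableB; [exact: cderivable_id|exact: cderivable_cst].
Qed.

Lemma bdry_neq (x y x1 x2 y1 y2 u v : R) : x1 < x < x2 -> y1 < y < y2 ->
  (u \in [:: x1; x2]) || (v \in [:: y1; y2]) -> u +i* v != x +i* y.
Proof.
move=> /andP[? ?] /andP[? ?] uv; apply/eqP => -[? ?]; subst u v.
by move: uv; rewrite !inE => /orP[/orP[]|/orP[]] /eqP ?; lra.
Qed.

(** Away from [z] the integrand is [g w + d + f z / (w - z)], where [g] is the first-order error
    divided by [w - z]. The contour of [g] shrinks to zero, that of the constant [d] vanishes, and
    the last term is the explicit residue. *)
Lemma cauchy_formula f (x y x1 x2 y1 y2 : R) : entire f ->
  x1 < x < x2 -> y1 < y < y2 ->
  Re_contour (fun w => f w / (w - (x +i* y))) x1 x2 y1 y2 = - (2 * pi) * Im (f (x +i* y)).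
Proof.
move=> fE xP yP; have /andP[x1x xx2] := xP; have /andP[y1y yy2] := yP.
have x12 : x1 <= x2 by lra.
have y12 : y1 <= y2 by lra.
set z := x +i* y.
have [d fd] : exists d, cdiff f z d by exact/derivable_cdiff.
pose num w := f w - (f z + d * (w - z)).
(* At w = z the junk value num z / 0 = 0 is the limit of g, so that g is
   continuous everywhere. *)
pose g w := num w / (w - z).
have numD w : cderivable num w.
  apply: cderivableB; first exact: fE.
  have -> : (fun w => f z + d * (w - z)) = (fun w => d * w - (d * z - f z)).
    by apply/funext => t; ring.
  apply: cderivableB; last exact: cderivable_cst.
  by apply: cderivableM; [exact: cderivable_cst|exact: cderivable_id].
have gD w : w != z -> cderivable g w.
  by move=> wz; apply: cderivableM => //; exact: cderivable_pole.
have gbnd e : 0 < e -> exists2 r : R, 0 < r & forall w, cmod (w - z) < r -> cmod (g w) <= e.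
  move=> e0; have [r r0 rP] := fd _ e0; exists r => // w /rP.
  rewrite [z + _]addrC subrK /g /num opprD addrA.
  have [->|wz] := eqVneq w z; first by rewrite !subrr invr0 !mulr0 cmod0 => _; exact: ltW.
  by rewrite cmodM cmodV ler_pdivrMr // cmod_gt0 subr_eq0.
have gc w : ccont g w.
  have [->|/gD/cderivable_ccont//] := eqVneq w z.
  move=> e /gbnd[r r0 rP]; exists r => // t /rP.
  by rewrite {3}/g subrr invr0 mulr0 subr0.
have g0 : Re_contour g x1 x2 y1 y2 = 0.
  apply/eqP; rewrite -normr_eq0 eq_le normr_ge0 andbT; apply/ler_addgt0Pr => e e0.
  (* On the square of half-side [eta <= 1] the bound is [2 * (e / 8) * (4 * eta) = e * eta]. *)
  rewrite add0r; have [|r r0 rP] := @gbnd (e / 8); first by lra.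
  pose eta := Num.min 1 (Num.min (r / 3) (Num.min (Num.min (x - x1) (x2 - x)) (Num.min (y - y1) (y2 - y)))).
  have : eta <= eta by []; rewrite {2}/eta !le_min -!andbA.
  move=> /andP[e1 /and5P[er ex1 ex2 ey1 ey2]].
  have eta0 : 0 < eta by rewrite !lt_min -!andbA; apply/andP; split; [|apply/and5P; split]; lra.
  rewrite (@Re_contour_shrink _ _ x y _ _ _ _ (x - eta) (x + eta) (y - eta) (y + eta))//;
    try (apply/andP; split; lra).
  apply: (@le_trans _ _ (2 * (e / 8) * (((x + eta) - (x - eta)) + ((y + eta) - (y - eta))))).
    apply: Re_contour_bound; [lra|lra|by move=> *; exact: gc|].
    move=> u v uP vP _; apply: rP; apply: (le_lt_trans (ler_cmod_ReIm _)) => /=.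
    have : `|u - x| <= eta by rewrite ler_distl; lra.
    have : `|v - y| <= eta by rewrite ler_distl; lra.
    lra.
  by nra.
rewrite (@eq_ReC _ _ _ _ _ x12 y12 _ (fun w => (g w + d) + f z / (w - z))); last first.
  move=> u v uP vP uv; rewrite /g /num.
  have : (u +i* v) - z != 0 by rewrite subr_eq0 (bdry_neq xP yP).
  by move=> H; field.
have polec (k : C) : forall u v, u +i* v != z -> ccont (fun w => k / (w - z)) (u +i* v).
  move=> u v uv; apply/cderivable_ccont/cderivableM; first exact: cderivable_cst.
  exact: cderivable_pole.
have cc k w : ccont (fun=> k) w by exact/cderivable_ccont/cderivable_cst.
have gdc w : ccont (fun w => g w + d) w.
  move=> e /(gc w)[r r0 rP]; exists r => // t /rP.
  by rewrite opprD addrACA subrr addr0.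
rewrite Re_contourD//; last by move=> u v _ _ uv; apply: polec; exact: bdry_neq uv.
rewrite Re_contourD//.
rewrite g0 Re_contour_cst// !add0r.
(* The given rectangle and the square of [Re_contour_residue] need not be nested; both are shrunk to
   a common square. *)
pose eta := Num.min 1 (Num.min (Num.min (x - x1) (x2 - x)) (Num.min (y - y1) (y2 - y))).
have : eta <= eta by []; rewrite {2}/eta !le_min -!andbA.
move=> /and5P[e1 ex1 ex2 ey1 ey2].
have eta0 : 0 < eta by rewrite !lt_min -!andbA; apply/and5P; split; lra.
have poleD w : w != z -> cderivable (fun w => f z / (w - z)) w.
  move=> wz; apply: cderivableM; first exact: cderivable_cst.
  exact: cderivable_pole.
rewrite -(Re_contour_residue (f z) x y).
rewrite (@Re_contour_shrink _ _ x y x1 x2 y1 y2 (x - eta) (x + eta) (y - eta) (y + eta))//;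
    try (apply/andP; split; lra).
rewrite -(@Re_contour_shrink _ _ x y (x - 1) (x + 1) (y - 1) (y + 1) (x - eta) (x + eta) (y - eta) (y + eta))//;
    by apply/andP; split; lra.
Qed.

(** Estimates of imaginary parts become estimates of moduli once the function is rotated by such a
    [c]. *)
Lemma norm_Im_arg z : exists2 c : C, cmod c = 1 & Im (c * z) = cmod z.
Proof.
have [->|z0] := eqVneq z 0; first by exists 1; rewrite ?cmod1// mulr0 cmod0.
have cz : cmod z != 0 by rewrite cmod_eq0.
exists ('i * (z^*)%C / (cmod z)%:C).
  have cJ : cmod (z^*)%C = cmod z by rewrite !cmodE; case: (z) => a b /=; rewrite sqrrN.
  rewrite !cmodM cmodi mul1r cmodV cJ cmod_real ger0_norm ?cmod_ge0//.
  by rewrite divff.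
have -> : 'i * (z^*)%C / (cmod z)%:C * z = 'i * ((z * (z^*)%C) / (cmod z)%:C).
  by rewrite mulrAC -!mulrA; congr (_ * _); rewrite mulrA [(z^*)%C * z]mulrC -mulrA.
rewrite -sqr_normc norm_cmod expr2 mulfK; last by rewrite (inj_eq (@complexI R)).
by rewrite cImM /= mul0r add0r mul1r.
Qed.

Lemma cmod_bdry (x y u v s : R) : x - s <= u <= x + s -> y - s <= v <= y + s ->
  (u \in [:: x - s; x + s]) || (v \in [:: y - s; y + s]) ->
  0 <= s -> s <= cmod ((u +i* v) - (x +i* y)).
Proof.
move=> /andP[? ?] /andP[? ?] uv s0.
have := ler_Re_cmod ((u +i* v) - (x +i* y)); have := ler_Im_cmod ((u +i* v) - (x +i* y)).
rewrite /= !ler_norml; move: uv; rewrite !inE => /orP[/orP[]|/orP[]] /eqP ?; subst; lra.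
Qed.

Lemma entireZ f k : entire f -> entire (fun w => k * f w).
Proof. by move=> fE z; apply: cderivableM; [exact: cderivable_cst|exact: fE]. Qed.

(** [L] comes from differentiating Cauchy's formula under the integral. The remaining kernel
    [h^2 / ((w - z)^2 (w - z - h))] is at most [cmod h ^+ 2 / 4] on the boundary of the square of
    half-side 2; the perimeter turns this into [4 * M * cmod h ^+ 2], and the 4 is absorbed by
    [2 * pi]. *)
Lemma cauchy_taylor_Im f (x y M : R) : entire f ->
  on_bdry (fun w => cmod (f w) <= M) (x - 2) (x + 2) (y - 2) (y + 2) ->
  exists L : C -> R, (forall (t : R) (h : C), L (t%:C * h) = t * L h) /\
    forall h : C, cmod h <= 1 ->
      `|Im (f ((x +i* y) + h)) - Im (f (x +i* y)) - L h| <= M * cmod h ^+ 2.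
Proof.
move=> fE fM; set z := x +i* y.
have xP : x - 2 < x < x + 2 by lra.
have yP : y - 2 < y < y + 2 by lra.
have x12 : x - 2 <= x + 2 by lra.
have y12 : y - 2 <= y + 2 by lra.
pose q (h w : C) := f w * h / (w - z) ^+ 2.
have nz u v : x - 2 <= u <= x + 2 -> y - 2 <= v <= y + 2 ->
  (u \in [:: x - 2; x + 2]) || (v \in [:: y - 2; y + 2]) ->
  2 <= cmod ((u +i* v) - z).
  by move=> uP vP uv; apply: cmod_bdry.
have z2D w : w != z -> cderivable (fun w => ((w - z) ^+ 2)^-1) w.
  move=> wz; apply: (@cderivableV (fun w => (w - z) ^+ 2)).
    by rewrite expf_neq0// subr_eq0.
  apply: (@cderivableM (fun w => w - z) (fun w => w - z));
  by apply: cderivableB; [exact: cderivable_id|exact: cderivable_cst].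
have qD h w : w != z -> cderivable (q h) w.
  move=> wz; apply: cderivableM; last exact: z2D.
  by apply: cderivableM; [exact: fE|exact: cderivable_cst].
have qc h : on_bdry (ccont (q h)) (x - 2) (x + 2) (y - 2) (y + 2).
  by move=> u v _ _ uv; apply/cderivable_ccont/qD; exact: bdry_neq uv.
have pi4 : 4 <= 2 * pi :> R by have := @pi_ge2 R; lra.
exists (fun h => - (2 * pi)^-1 * Re_contour (q h) (x - 2) (x + 2) (y - 2) (y + 2)); split.
  move=> t h; rewrite [RHS]mulrCA -[t * _]Re_contourZ//; congr (_ * _); apply: eq_ReC => // u v _ _ _.
  by rewrite /q; ring.
move=> h h1.
have [hx hy] : `|Re h| <= 1 /\ `|Im h| <= 1.
  by split; [exact: le_trans (ler_Re_cmod h) h1|exact: le_trans (ler_Im_cmod h) h1].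
have xP' : x - 2 < x + Re h < x + 2 by move: hx; rewrite ler_norml; lra.
have yP' : y - 2 < y + Im h < y + 2 by move: hy; rewrite ler_norml; lra.
have zh : z + h = (x + Re h) +i* (y + Im h) by rewrite /z; case: (h).
have := cauchy_formula fE xP' yP'; rewrite -zh.
have := cauchy_formula fE xP yP; rewrite -/z => F0 F1.
have nzh u v : x - 2 <= u <= x + 2 -> y - 2 <= v <= y + 2 ->
  (u \in [:: x - 2; x + 2]) || (v \in [:: y - 2; y + 2]) ->
  1 <= cmod ((u +i* v) - (z + h)).
  move=> uP vP uv; have := nz _ _ uP vP uv; rewrite opprD addrA.
  by have := ler_cmodBB ((u +i* v) - z) h; lra.
pose p h w := f w / (w - h).
have pD k w : w != k -> cderivable (p k) w.
  by move=> wk; apply: cderivableM; [exact: fE|exact: cderivable_pole].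
pose r w := (p (z + h) w - p z w) - q h w.
have bz u v : (u \in [:: x - 2; x + 2]) || (v \in [:: y - 2; y + 2]) -> u +i* v != z.
  exact: bdry_neq.
have bzh u v : (u \in [:: x - 2; x + 2]) || (v \in [:: y - 2; y + 2]) -> u +i* v != z + h.
  by rewrite zh; exact: bdry_neq.
have rc : on_bdry (ccont r) (x - 2) (x + 2) (y - 2) (y + 2).
  move=> u v _ _ uv; apply/cderivable_ccont/cderivableB; last exact/qD/bz.
  by apply: cderivableB; apply: pD; [exact: bzh|exact: bz].
have rM : on_bdry (fun w => cmod (r w) <= M * cmod h ^+ 2 / 4) (x - 2) (x + 2) (y - 2) (y + 2).
  move=> u v uP vP uv; have n0 := nz _ _ uP vP uv; have n1 := nzh _ _ uP vP uv.
  have M0 := fM _ _ uP vP uv.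
  set w := u +i* v in n0 n1 M0 *.
  have w0 : w - z != 0 by rewrite -cmod_gt0; lra.
  have w1 : w - (z + h) != 0 by rewrite -cmod_gt0; lra.
  have -> : r w = f w * (h ^+ 2 / ((w - z) ^+ 2 * (w - (z + h)))).
    by rewrite /r /p /q; field; apply/andP.
  rewrite cmodM -mulrA; apply: ler_pM => //; try exact: cmod_ge0.
  rewrite cmodM cmodX ler_wpM2l ?sqr_ge0//.
  rewrite cmodV cmodM cmodX lef_pV2 ?posrE//; last first.
    by rewrite mulr_gt0 ?exprn_gt0//; lra.
  nra.
have key : Re_contour r (x - 2) (x + 2) (y - 2) (y + 2) =
    (Re_contour (p (z + h)) (x - 2) (x + 2) (y - 2) (y + 2) -
     Re_contour (p z) (x - 2) (x + 2) (y - 2) (y + 2)) -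
     Re_contour (q h) (x - 2) (x + 2) (y - 2) (y + 2).
  have pc k : (forall u v, (u \in [:: x - 2; x + 2]) || (v \in [:: y - 2; y + 2]) -> u +i* v != k) ->
      on_bdry (ccont (p k)) (x - 2) (x + 2) (y - 2) (y + 2).
    by move=> H u v _ _ uv; exact/cderivable_ccont/pD/H.
  have pc0 := pc _ bz; have pc1 := pc _ bzh.
  have qpc : on_bdry (ccont (fun w => q h w + p z w)) (x - 2) (x + 2) (y - 2) (y + 2).
    by move=> u v _ _ uv; apply/cderivable_ccont/derivableD; [exact/qD/bz|exact/pD/bz].
  have -> : Re_contour (p (z + h)) (x - 2) (x + 2) (y - 2) (y + 2) =
      Re_contour (fun w => r w + (q h w + p z w)) (x - 2) (x + 2) (y - 2) (y + 2).
    by apply: eq_ReC => // u v _ _ _; rewrite /r; ring.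
  by rewrite (Re_contourD x12 y12 rc qpc) (Re_contourD x12 y12 (qc h) pc0); ring.
have := Re_contour_bound x12 y12 rc rM.
rewrite key -/(p (z + h)) -/(p z) in F0 F1 *.
rewrite F0 F1; set Q := Re_contour (q h) _ _ _ _; set B := M * _.
have -> : Im (f (z + h)) - Im (f z) - - (2 * pi)^-1 * Q =
   - (2 * pi)^-1 * (- (2 * pi) * Im (f (z + h)) - - (2 * pi) * Im (f z) - Q).
  have : (pi : R) != 0 by rewrite gt_eqF// pi_gt0.
  by move: (pi : R) => t t0; field.
move=> H; rewrite normrM normrN normfV (ger0_norm (x := 2 * pi)); last lra.
rewrite mulrC ler_pdivrMr; last lra.
apply: (le_trans H); have : 0 <= B; last by nra.
have M0 : 0 <= M.
  apply: le_trans (cmod_ge0 (f ((x - 2) +i* (y - 2)))) _.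
  by apply: fM; rewrite ?lexx//= !inE eqxx.
by rewrite mulr_ge0// sqr_ge0.
Qed.

(** The imaginary-part estimate is applied to [f] and to ['i * f], whose imaginary part is the real
    part of [f]. The constant depends on [f] only through [M], which makes the bound uniform over
    families. *)
Lemma cauchy_taylor f (x y M : R) d : entire f -> cdiff f (x +i* y) d ->
  on_bdry (fun w => cmod (f w) <= M) (x - 2) (x + 2) (y - 2) (y + 2) ->
  forall h : C, cmod h <= 1 ->
    cmod (f ((x +i* y) + h) - f (x +i* y) - d * h) <= 2 * M * cmod h ^+ 2.
Proof.
set z := x +i* y.
have half g d' : entire g -> cdiff g z d' ->
    on_bdry (fun w => cmod (g w) <= M) (x - 2) (x + 2) (y - 2) (y + 2) ->
    forall h : C, cmod h <= 1 -> `|Im (g (z + h) - g z - d' * h)| <= M * cmod h ^+ 2.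
  move=> gE gd gM; have [L [LZ LP]] := cauchy_taylor_Im gE gM.
  (* Both sides are R-homogeneous, hence compared along t h as t tends to 0. *)
  suff Ld h : cmod h <= 1 -> L h = Im (d' * h).
    by move=> h h1; rewrite !cImB -Ld//; exact: LP.
  move=> h1; apply/eqP; rewrite -subr_eq0 -normr_eq0 eq_le normr_ge0 andbT.
  apply/ler_addgt0Pr => e e0; rewrite add0r.
  have [r r0 rP] := gd _ (divr_gt0 e0 (ltr0n R 2)).
  have M0 : 0 <= M.
    apply: le_trans (cmod_ge0 (g ((x - 2) +i* (y - 2)))) _.
    by apply: gM; rewrite ?lexx//=; [lra|lra|rewrite !inE eqxx].
  (* Along [t h] the Taylor error is at most [t * (t * M)] and the differentiability error at most
     [t * (e / 2)]; with [t * M <= e / 2] division by [t] leaves [e]. *)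
  pose t := Num.min 1 (Num.min (r / 2) (e / (2 * (1 + M)))).
  have [t0 t1 tr te] : [/\ 0 < t, t <= 1, t <= r / 2 & t <= e / (2 * (1 + M))].
    split; rewrite /t ?lt_min ?ge_min ?lexx ?orbT//.
    by rewrite ltr01 !divr_gt0//; lra.
  have te' : t * M <= e / 2.
    move: te; rewrite invfM mulrA ler_pdivlMr; last lra.
    by move=> ?; nra.
  have h0 := cmod_ge0 h.
  have ct : cmod (t%:C * h) = t * cmod h by rewrite cmodM cmod_real ger0_norm// ltW.
  have := LP (t%:C * h); rewrite ct LZ => A.
  have : t * cmod h <= 1 by nra.
  move=> /A {A}A.
  have := rP (t%:C * h); rewrite ct => B.
  have : t * cmod h < r by nra.
  move=> /B{B}/(le_trans (ler_Im_cmod _)); rewrite !cImB => B.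
  have -> : L h - Im (d' * h) = t^-1 * (t * L h - Im (d' * (t%:C * h))).
    have -> : Im (d' * (t%:C * h)) = t * Im (d' * h) by rewrite !cImM !cReM /=; ring.
    by rewrite -mulrBr mulKf// gt_eqF.
  rewrite normrM normfV (gtr0_norm t0) mulrC ler_pdivrMr//.
  move: A B; rewrite -/z; set D := Im (g _) - Im (g z); set l := t * L h; set k := Im _.
  rewrite exprMn => A B.
  have : `|l - k| <= `|D - l| + `|D - k|.
    have := ler_normB (D - k) (D - l).
    have -> : D - k - (D - l) = l - k by ring.
    by lra.
  move=> /le_trans; apply.
  apply: (le_trans (lerD A B)).
  have hh : cmod h ^+ 2 <= 1 by rewrite expr_le1.
  have : M * (t ^+ 2 * cmod h ^+ 2) <= (t * M) * t.
    have : 0 <= t ^+ 2 * M by rewrite mulr_ge0// sqr_ge0.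
    by nra.
  have : t * M * t <= e / 2 * t by rewrite ler_wpM2r// ltW.
  have : e / 2 * (t * cmod h) <= e / 2 * t.
    by rewrite ler_wpM2l ?divr_ge0 ?(ltW e0)// ler_piMr// ltW.
  by lra.
move=> fE fd fM h h1.
have := half f d fE fd fM h h1.
have iE : entire (fun w => 'i * f w) by exact: entireZ.
have id' : cdiff (fun w => 'i * f w) z ('i * d).
  move=> e /fd[r r0 rP]; exists r => // k /rP.
  have -> : 'i * f (z + k) - 'i * f z - 'i * d * k = 'i * (f (z + k) - f z - d * k) by ring.
  by rewrite cmodM cmodi mul1r.
have := half _ _ iE id' _ h h1; rewrite (_ : _ - 'i * d * h = 'i * (f (z + h) - f z - d * h)); last by ring.
rewrite cImM /= mul0r add0r mul1r => H1 H2.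
apply: (le_trans (ler_cmod_ReIm _)).
have : `|Re (f (z + h) - f z - d * h)| <= M * cmod h ^+ 2.
  apply: H1; apply: on_bdry_imp fM => w.
  by rewrite cmodM cmodi mul1r.
by lra.
Qed.

End CauchyEstimates.

(** * Pointwise bounds from integral bounds *)

Section PointwiseBound.
Context {R : realType}.
Local Notation C := R[i].
Local Notation Re := (@complex.Re R).
Local Notation Im := (@complex.Im R).
Local Notation mu := (@lebesgue_measure R).
Implicit Types (f g : C -> C) (h z w d k : C).

(** Rounding the first coordinate down to the grid of step [1 / n.+1] gives functions whose
    preimages are countable unions of measurable rectangles; by continuity in the first variable
    they converge pointwise to [g]. *)
Lemma measurable_separately_continuous (g : R * R -> R) :
  (forall y, continuous (fun x => g (x, y))) -> (forall x, continuous (fun y => g (x, y))) ->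
  measurable_fun setT g.
Proof.
move=> cx cy.
pose a n (x : R) : R := (Num.floor (n.+1%:R * x))%:~R / n.+1%:R.
apply: (@measurable_fun_cvg _ _ _ _ (fun n (u : R * R) => g (a n u.1, u.2))).
  move=> n _ B mB; rewrite setTI.
  have -> : (fun u : R * R => g (a n u.1, u.2)) @^-1` B =
    \bigcup_(k : int) (`[(k%:~R / n.+1%:R : R), ((k + 1)%:~R / n.+1%:R : R)[%classic `*`
       ((fun y => g (k%:~R / n.+1%:R, y)) @^-1` B)).
    apply/seteqP; split=> [[x y] /= Bxy|[x y] [k _] /= [xk Bxy]].
      exists (Num.floor (n.+1%:R * x)) => //=; split => //=.
      rewrite in_itv /= ler_pdivrMr// ltr_pdivlMr// [x * _]mulrC.
      by rewrite floor_le_tmp floorD1_gt.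
    have -> // : a n x = k%:~R / n.+1%:R.
    rewrite /a; congr (_%:~R / _); apply: floor_def.
    by move: xk; rewrite in_itv /= ler_pdivrMr// ltr_pdivlMr// [x * _]mulrC.
  apply: countable_bigcupT_measurable => // k.
  apply: measurableX; first exact: measurable_itv.
  rewrite -[X in measurable X]setTI.
  by apply: continuous_measurable_fun => //; exact: cx.
move=> [x y] _ /=.
apply: (@cvg_comp _ _ _ (fun n => a n x) (fun t => g (t, y)) _ (nbhs x)); last exact: cx.
apply/cvgrPdist_lt => e e0; near=> n.
have n0 : 0 < n.+1%:R :> R by [].
have : n.+1%:R^-1 < e by near: n; exact: near_infty_natSinv_lt (PosNum e0).
apply: le_lt_trans; rewrite /a.
have -> : x - (Num.floor (n.+1%:R * x))%:~R / n.+1%:R =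
  (n.+1%:R * x - (Num.floor (n.+1%:R * x))%:~R) / n.+1%:R.
  by rewrite mulrBl mulrAC mulfV ?mul1r// gt_eqF.
rewrite normrM normfV (gtr0_norm n0) -[leRHS]mul1r ler_wpM2r ?invr_ge0//.
have /andP[] := floor_itv (n.+1%:R * x).
by rewrite intrD ler_norml; lra.
Unshelve. all: by end_near. Qed.

Lemma ccont_cont_cmod_h f (y : R) : (forall z, ccont f z) ->
  continuous (fun x => cmod (f (x +i* y))).
Proof.
move=> fc x; apply/cvgrPdist_le => e /(fc (x +i* y))[r r0 rP].
near=> t; apply: (@le_trans _ _ (cmod (f (t +i* y) - f (x +i* y)))).
  have := ler_cmodBB (f (t +i* y)) (f (x +i* y)).
  have := ler_cmodBB (f (x +i* y)) (f (t +i* y)); rewrite [cmod (f (x +i* y) - _)]cmodB.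
  by rewrite ler_norml; lra.
apply: rP; have -> : (t +i* y) - (x +i* y) = (t - x)%:C.
  by apply/eqP; rewrite eq_complex /= subrr !eqxx.
by rewrite cmod_real distrC; near: t; apply: cvgr_dist_lt.
Unshelve. all: by end_near. Qed.

Lemma ccont_cont_cmod_v f (x : R) : (forall z, ccont f z) ->
  continuous (fun y => cmod (f (x +i* y))).
Proof.
move=> fc y; apply/cvgrPdist_le => e /(fc (x +i* y))[r r0 rP].
near=> t; apply: (@le_trans _ _ (cmod (f (x +i* t) - f (x +i* y)))).
  have := ler_cmodBB (f (x +i* t)) (f (x +i* y)).
  have := ler_cmodBB (f (x +i* y)) (f (x +i* t)); rewrite [cmod (f (x +i* y) - _)]cmodB.
  by rewrite ler_norml; lra.
apply: rP; have -> : (x +i* t) - (x +i* y) = 'i * (t - y)%:C.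
  by apply/eqP; rewrite eq_complex /=; apply/andP; split; apply/eqP; ring.
by rewrite cmodM cmodi mul1r cmod_real distrC; near: t; apply: cvgr_dist_lt.
Unshelve. all: by end_near. Qed.

Lemma entire_ccont f : entire f -> forall z, ccont f z.
Proof. by move=> fE z; exact/cderivable_ccont/fE. Qed.

Lemma measurable_cmod f : (forall z, ccont f z) ->
  measurable_fun setT (fun u : R * R => cmod (f (u.1 +i* u.2))).
Proof.
move=> fc; apply: measurable_separately_continuous => t /=.
  exact: ccont_cont_cmod_h.
exact: ccont_cont_cmod_v.
Qed.

(** All sides are at distance at least 1 from the point, so the Cauchy kernel has modulus at most 1
    there. *)
Lemma cauchy_sides f (x y x1 x2 y1 y2 : R) : entire f ->
  x1 <= x - 1 -> x + 1 <= x2 -> y1 <= y - 1 -> y + 1 <= y2 ->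
  2 * pi * cmod (f (x +i* y)) <=
    intR x1 x2 (fun x => cmod (f (x +i* y1))) + intR x1 x2 (fun x => cmod (f (x +i* y2))) +
    (intR y1 y2 (fun y => cmod (f (x1 +i* y))) + intR y1 y2 (fun y => cmod (f (x2 +i* y)))).
Proof.
move=> fE X1 X2 Y1 Y2; have [c c1 cf] := norm_Im_arg (f (x +i* y)).
have gE := entireZ (k := c) fE; set g := fun w => c * f w in gE.
have xP : x1 < x < x2 by lra.
have yP : y1 < y < y2 by lra.
have := cauchy_formula gE xP yP; rewrite /g cf => F.
have -> : 2 * pi * cmod (f (x +i* y)) = `|- (2 * pi) * cmod (f (x +i* y))|.
  by rewrite mulNr normrN ger0_norm// !mulr_ge0// ?pi_ge0// cmod_ge0.
have fc := entire_ccont fE.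
rewrite -F; apply: (@Re_contour_le _ _ _ _ _ _ _ _ (fun w => cmod (f w))); try lra.
- move=> u v _ _ uv; apply/cderivable_ccont/cderivableM; first exact: gE.
  by apply: cderivable_pole; exact: bdry_neq uv.
- move=> u v uP vP uv; rewrite !cmodM c1 mul1r cmodV ler_piMr ?cmod_ge0//.
  rewrite invf_le1; last first.
    by rewrite cmod_gt0 subr_eq0; exact: bdry_neq uv.
  have := ler_Re_cmod ((u +i* v) - (x +i* y)); have := ler_Im_cmod ((u +i* v) - (x +i* y)).
  rewrite /= !ler_norml; move: uv; rewrite !inE => /orP[/orP[]|/orP[]] /eqP /= ?; subst; lra.
- by move=> t _; exact: ccont_cont_cmod_h.
- by move=> t _; exact: ccont_cont_cmod_h.
- by move=> t _; exact: ccont_cont_cmod_v.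
- by move=> t _; exact: ccont_cont_cmod_v.
Qed.

(** Otherwise [V] would exceed [K + 1] on an interval of length 1, and its integral would be larger
    than [K]. *)
Lemma exists_small_fiber (V : R -> \bar R) (K a : R) :
  measurable_fun setT V -> (forall x, 0 <= V x)%E -> (\int[mu]_x V x <= K%:E)%E ->
  exists2 t, a <= t <= a + 1 & (V t <= (K + 1)%:E)%E.
Proof.
move=> mV V0 VK; apply: contrapT => H.
have HV t : a <= t <= a + 1 -> ((K + 1)%:E <= V t)%E.
  move=> tP; rewrite leNgt; apply/negP => Vt; apply: H; exists t => //.
  exact: ltW.
have : (\int[mu]_(x in `[a, (a + 1)%R]%classic) (K + 1)%:E <= K%:E)%E.
  apply: (le_trans _ VK); apply: (@le_trans _ _ (\int[mu]_(x in `[a, (a + 1)%R]%classic) V x)%E).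
    have K0 : (0 <= K + 1)%R.
      have : (0 <= \int[mu]_x V x)%E by exact: integral_ge0.
      by move=> /le_trans /(_ VK); rewrite lee_fin; lra.
    apply: ge0_le_integral => //.
    by apply: measurable_funTS.
  by apply: ge0_subset_integral => //; exact: measurableT.
rewrite integral_cst//= lebesgue_measure_itv /= lte_fin ltrDl ltr01.
by rewrite -EFinB -EFinM lee_fin addrAC subrr add0r mulr1; lra.
Qed.


Lemma side_integral_le (g W : R -> R) (a b t K : R) : a <= b -> 0 <= t ->
  continuous g -> measurable_fun setT W -> (forall x, 0 <= W x) ->
  (\int[mu]_x (W x)%:E <= K%:E)%E ->
  (forall x, a <= x <= b -> g x <= t * (1 + W x)) -> (forall x, 0 <= g x) ->
  intR a b g <= t * ((b - a) + K).
Proof.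
move=> ab t0 gc mW W0 WK gW g0.
have gi : mu.-integrable `[a, b]%classic (EFin \o g).
  by apply: cts_integrable => x _; exact: gc.
rewrite -lee_fin /intR /Rintegral fineK; last exact: integrable_fin_num.
apply: (@le_trans _ _ (\int[mu]_(x in `[a, b]%classic) (t%:E * (1%:E + (W x)%:E)))%E).
  apply: ge0_le_integral => //.
  - by move=> x _; rewrite lee_fin.
  - exact: measurable_int gi.
  - apply/measurable_EFinP; apply: measurable_funM => //.
    by apply: measurable_funD => //; exact: measurable_funTS.
have mW' : measurable_fun `[a, b]%classic (EFin \o W).
  by apply/measurable_EFinP; exact: measurable_funTS.
rewrite ge0_integralZl//; last 2 first.
- by apply/measurable_EFinP; apply: measurable_funD => //; exact: measurable_funTS.
- by move=> x _; rewrite -EFinD lee_fin addr_ge0.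
rewrite EFinM lee_pmul//; first by apply: integral_ge0 => x _; rewrite -EFinD lee_fin addr_ge0.
rewrite ge0_integralD//.
rewrite EFinD leeD//.
  rewrite integral_cst//= mul1e lebesgue_measure_itv /= lte_fin.
  by case: ifPn => // _; rewrite lee_fin subr_ge0.
apply: le_trans WK; apply: ge0_subset_integral => //.
- by apply/measurable_EFinP.
- by move=> x _; rewrite lee_fin.
- by move=> x _; rewrite lee_fin.
Qed.

Definition fock_weight (alpha r : R) f (u : R * R) : R :=
  cmod (f (u.1 +i* u.2)) `^ r * expR (- (alpha * r / 2 * cmod (u.1 +i* u.2) ^+ 2)).

Lemma fock_weight_ge0 alpha r f u : 0 <= fock_weight alpha r f u.
Proof. by rewrite mulr_ge0 ?powR_ge0 ?expR_ge0. Qed.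

Lemma measurable_fock_weight alpha r f : (forall z, ccont f z) ->
  measurable_fun setT (fock_weight alpha r f).
Proof.
move=> fc; apply: measurable_funM.
  by apply: (measurableT_comp (measurable_powR _)) => //; exact: measurable_cmod.
have idc z : ccont (fun w => w) z by exact/cderivable_ccont/cderivable_id.
apply: measurableT_comp => //; apply: measurableT_comp => //.
by apply: measurable_funM => //; apply: measurable_funX; exact: (measurable_cmod idc).
Qed.

Lemma cmod_le_weight alpha r f u (B : R) : 0 < alpha -> 1 <= r ->
  cmod (u.1 +i* u.2) ^+ 2 <= B ->
  cmod (f (u.1 +i* u.2)) <= expR (alpha / 2 * B) * (1 + fock_weight alpha r f u).
Proof.
move=> al0 r1 uB; set t := expR _; have t0 : 0 < t by exact: expR_gt0.
have W0 := fock_weight_ge0 alpha r f u.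
have [le|/ltW lt] := leP (cmod (f (u.1 +i* u.2))) t.
  by rewrite (le_trans le)// ler_peMr ?(ltW t0)// lerDl.
set A := cmod _ in lt *.
have At : 1 <= A / t by rewrite ler_pdivlMr// mul1r.
have A0 : 0 <= A by rewrite cmod_ge0.
rewrite mulrC -ler_pdivrMr//.
apply: (@le_trans _ _ (fock_weight alpha r f u)); last by rewrite lerDr.
apply: (le_trans (le1r_powR At r1)).
rewrite powRM ?invr_ge0 ?(ltW t0)// /fock_weight -/A ler_wpM2l ?powR_ge0//.
rewrite -expRN /powR gt_eqF ?expR_gt0// expRK ler_expR.
have -> : r * - (alpha / 2 * B) = - (alpha * r / 2 * B) by ring.
by rewrite lerN2 ler_wpM2l// !mulr_ge0//; lra.
Qed.

Lemma growth_of_integral alpha r f (K x y : R) : 0 < alpha -> 1 <= r -> entire f ->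
  (\int[(mu \x mu)%E]_u (fock_weight alpha r f u)%:E <= K%:E)%E ->
  cmod (f (x +i* y)) <= (K + 5) * expR (alpha / 2 * (cmod (x +i* y) + 3) ^+ 2).
Proof.
move=> al0 r1 fE WK; have fc := entire_ccont fE.
set W := fock_weight alpha r f in WK *.
have W0 u : (0 <= (W u)%:E)%E by rewrite lee_fin fock_weight_ge0.
have mW : measurable_fun setT W by exact: measurable_fock_weight.
have mWe : measurable_fun setT (EFin \o W) by exact/measurable_EFinP.
have WX : (\int[mu]_x (\int[mu]_y (W (x, y))%:E) <= K%:E)%E.
  apply: (le_trans _ WK); rewrite le_eqVlt; apply/orP; left; apply/eqP/esym.
  exact: (fubini_tonelli1 (m1 := mu) (m2 := mu) (EFin \o W) mWe W0).
have WY : (\int[mu]_y (\int[mu]_x (W (x, y))%:E) <= K%:E)%E.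
  apply: (le_trans _ WK); rewrite le_eqVlt; apply/orP; left; apply/eqP/esym.
  exact: (fubini_tonelli2 (m1 := mu) (m2 := mu) (EFin \o W) mWe W0).
have mX := measurable_fun_fubini_tonelli_F (T1 := measurableTypeR R) (m2 := mu) (EFin \o W) mWe W0.
have mY := measurable_fun_fubini_tonelli_G (T2 := measurableTypeR R) (m1 := mu) (EFin \o W) mWe W0.
have X0 t : (0 <= \int[mu]_y (W (t, y))%:E)%E by apply: integral_ge0.
have Y0 t : (0 <= \int[mu]_x (W (x, t))%:E)%E by apply: integral_ge0.
(* The sides of the rectangle are lines on which the weight has a controlled
   integral. *)
have [x1 x1P Vx1] := exists_small_fiber (x - 2) mX X0 WX.
have [x2 x2P Vx2] := exists_small_fiber (x + 1) mX X0 WX.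
have [y1 y1P Vy1] := exists_small_fiber (y - 2) mY Y0 WY.
have [y2 y2P Vy2] := exists_small_fiber (y + 1) mY Y0 WY.
(* The rectangle lies in the square of half-side 2 around [z], whose half-diagonal is less than
   3. *)
pose z := x +i* y; pose B := (cmod z + 3) ^+ 2; pose t := expR (alpha / 2 * B).
have t0 : 0 < t by exact: expR_gt0.
have inB u v : x - 2 <= u <= x + 2 -> y - 2 <= v <= y + 2 -> cmod (u +i* v) ^+ 2 <= B.
  move=> uP vP; rewrite ler_pXn2r ?nnegrE ?cmod_ge0 ?addr_ge0 ?cmod_ge0//.
  have -> : u +i* v = z + ((u - x) +i* (v - y)).
    by apply/eqP; rewrite eq_complex /=; apply/andP; split; apply/eqP; ring.
  apply: (le_trans (ler_cmodD _ _)); rewrite lerD2l.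
  rewrite -(ler_pXn2r (_ : 0 < 2)%N) ?nnegrE ?cmod_ge0// sqr_cmod /=.
  have : (u - x) ^+ 2 <= 4 by nra.
  have : (v - y) ^+ 2 <= 4 by nra.
  have -> : (3 : R) ^+ 2 = 9 by ring.
  by lra.
have pt : forall u v, x - 2 <= u <= x + 2 -> y - 2 <= v <= y + 2 ->
    cmod (f (u +i* v)) <= t * (1 + W (u, v)).
  by move=> u v uP vP; apply: (@cmod_le_weight _ _ _ (u, v)) => //=; exact: inB.
have h1 : intR x1 x2 (fun x => cmod (f (x +i* y1))) <= t * ((x2 - x1) + (K + 1)).
  have ab : x1 <= x2 by clear -x1P x2P; lra.
  apply: (side_integral_le ab (ltW t0) (ccont_cont_cmod_h (y := y1) fc) (measurable_fun_pair1 y1 mW) _ Vy1).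
  - by move=> u; exact: fock_weight_ge0.
  - by move=> u uP; apply: pt; clear -uP x1P x2P y1P y2P; lra.
  - by move=> u; rewrite cmod_ge0.
have h2 : intR x1 x2 (fun x => cmod (f (x +i* y2))) <= t * ((x2 - x1) + (K + 1)).
  have ab : x1 <= x2 by clear -x1P x2P; lra.
  apply: (side_integral_le ab (ltW t0) (ccont_cont_cmod_h (y := y2) fc) (measurable_fun_pair1 y2 mW) _ Vy2).
  - by move=> u; exact: fock_weight_ge0.
  - by move=> u uP; apply: pt; clear -uP x1P x2P y1P y2P; lra.
  - by move=> u; rewrite cmod_ge0.
have h3 : intR y1 y2 (fun y => cmod (f (x1 +i* y))) <= t * ((y2 - y1) + (K + 1)).
  have ab : y1 <= y2 by clear -y1P y2P; lra.
  apply: (side_integral_le ab (ltW t0) (ccont_cont_cmod_v (x := x1) fc) (measurable_fun_pair2 x1 mW) _ Vx1).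
  - by move=> u; exact: fock_weight_ge0.
  - by move=> u uP; apply: pt; clear -uP x1P x2P y1P y2P; lra.
  - by move=> u; rewrite cmod_ge0.
have h4 : intR y1 y2 (fun y => cmod (f (x2 +i* y))) <= t * ((y2 - y1) + (K + 1)).
  have ab : y1 <= y2 by clear -y1P y2P; lra.
  apply: (side_integral_le ab (ltW t0) (ccont_cont_cmod_v (x := x2) fc) (measurable_fun_pair2 x2 mW) _ Vx2).
  - by move=> u; exact: fock_weight_ge0.
  - by move=> u uP; apply: pt; clear -uP x1P x2P y1P y2P; lra.
  - by move=> u; rewrite cmod_ge0.
have [X1 X2 Y1 Y2] : [/\ x1 <= x - 1, x + 1 <= x2, y1 <= y - 1 & y + 1 <= y2].
  by clear -x1P x2P y1P y2P; split; lra.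
have := cauchy_sides fE X1 X2 Y1 Y2; rewrite -/z => S.
(* Each side has length at most 4 and contributes at most [t * (K + 5)]; the factor 4 for the four
   sides is absorbed by [2 * pi]. *)
have pi4 : 4 <= 2 * pi :> R by have := @pi_ge2 R; lra.
have lx : t * (x2 - x1) <= t * 4 by rewrite ler_wpM2l ?(ltW t0)//; lra.
have ly : t * (y2 - y1) <= t * 4 by rewrite ler_wpM2l ?(ltW t0)//; lra.
have := cmod_ge0 (f z).
have : 4 * cmod (f z) <= 2 * pi * cmod (f z) by rewrite ler_wpM2r ?cmod_ge0.
rewrite -/z -/B -/t.
move: h1 h2 h3 h4 lx ly S; rewrite ![t * _]mulrDr; lra.
Qed.

End PointwiseBound.

(** * Montel's theorem *)

Section Montel.
Context {R : realType}.
Local Notation C := R[i].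
Local Notation Re := (@complex.Re R).
Local Notation Im := (@complex.Im R).
Implicit Types (f g : C -> C) (h z w d k : C).

(** The image of [U] clusters in the compact segment, and a cluster point of an ultrafilter is a
    limit. *)
Lemma ultra_limit_real (U : set_system nat) (x : nat -> R) (M : R) :
  UltraFilter U -> (forall n, `|x n| <= M) ->
  exists l, forall e, 0 < e -> U [set n | `|x n - l| <= e].
Proof.
move=> UU xM; have UF : Filter U by exact: ultra_proper.
have UP : ProperFilter U by exact: ultra_proper.
have := @segment_compact R (- M) M.
move=> /(_ (x @ U) _)[|l [_ lP]].
  by apply: (@filterE _ U) => n; rewrite /= in_itv /= -ler_norml; exact: xM.
exists l => e e0; have [//|nU] := in_ultra_setVsetC [set n | `|x n - l| <= e] UU.
exfalso; have [||t []] := lP [set t | ~~ (`|t - l| <= e)] [set t | `|t - l| < e].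
- by apply: (@filterS _ U _ _ _ _ nU) => n /= /negP.
- by apply/nbhs_ballP; exists e => // t /=; rewrite /ball/= distrC.
- by move=> /= /negP te /ltW.
Qed.

Lemma ultra_limit (U : set_system nat) (x : nat -> C) (M : R) :
  UltraFilter U -> (forall n, cmod (x n) <= M) ->
  exists l, forall e : R, 0 < e -> U [set n | cmod (x n - l) <= e].
Proof.
move=> UU xM; have UF : Filter U by exact: ultra_proper.
have [l1 l1P] := @ultra_limit_real U (fun n => Re (x n)) M UU (fun n => le_trans (ler_Re_cmod _) (xM n)).
have [l2 l2P] := @ultra_limit_real U (fun n => Im (x n)) M UU (fun n => le_trans (ler_Im_cmod _) (xM n)).
exists (l1 +i* l2) => e e0; have e20 : 0 < e / 2 by rewrite divr_gt0.
apply: filterS (filterI (l1P _ e20) (l2P _ e20)) => n /= [H1 H2].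
by rewrite (le_trans (ler_cmod_ReIm _))// cReB cImB /=; lra.
Qed.

(* Limits along a free ultrafilter replace the diagonal extraction; the
   second-order Taylor bound passes to them and shows that they are entire. *)
Lemma montel (G : nat -> C -> C) (B : R -> R) : (forall n, entire (G n)) ->
  (forall n z r, cmod z <= r -> cmod (G n z) <= B r) ->
  exists (s : nat -> nat) g, [/\ {homo s : m n / (m < n)%N >-> (m < n)%N},
    entire g & forall r e : R, 0 < e -> exists N, forall m, (N <= m)%N ->
      forall z, cmod z <= r -> cmod (G (s m) z - g z) <= e].
Proof.
move=> GE GB; have [U [UU Uoo]] := ultraFilterLemma eventually_filter.
have UF : Filter U by exact: ultra_proper.
have UP : ProperFilter U by exact: ultra_proper.
have /choice[g gP] z : exists l, forall e : R, 0 < e -> U [set n | cmod (G n z - l) <= e].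
  by apply: (@ultra_limit _ _ (B (cmod z))) => // n; exact: GB.
have /choice[D DP] (nz : nat * C) : exists d, cdiff (G nz.1) nz.2 d.
  by apply/derivable_cdiff; exact: GE.
(* The radius 3 covers the square of half-side 2 on whose boundary [cauchy_taylor] asks for a
   bound. *)
pose M z := B (cmod z + 3).
have GM n z h : cmod h <= 3 -> cmod (G n (z + h)) <= M z.
  by move=> h3; apply: GB; rewrite (le_trans (ler_cmodD _ _))// lerD2l.
have M0 z : 0 <= M z.
  by apply: le_trans (cmod_ge0 _) (GM 0%N z 0 _); rewrite cmod0.
have taylor n z h : cmod h <= 1 ->
    cmod (G n (z + h) - G n z - D (n, z) * h) <= 2 * M z * cmod h ^+ 2.
  have /= := DP (n, z); case: z => x y dP h1; apply: cauchy_taylor => //.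
  move=> u v uP vP _.
  have -> : u +i* v = (x +i* y) + ((u - x) +i* (v - y)).
    by apply/eqP; rewrite eq_complex /=; apply/andP; split; apply/eqP; ring.
  apply: GM; rewrite -(ler_pXn2r (_ : 0 < 2)%N) ?nnegrE ?cmod_ge0// sqr_cmod /=.
  have : (u - x) ^+ 2 <= 4 by nra.
  have : (v - y) ^+ 2 <= 4 by nra.
  have -> : (3 : R) ^+ 2 = 9 by ring.
  by lra.
have DM n z : cmod (D (n, z)) <= 4 * M z.
  have := taylor n z 1; rewrite cmod1 expr1n !mulr1 => /(_ (lexx _)).
  have := GM n z 0; rewrite cmod0 addr0 => /(_ (ler0n _ _)).
  have := GM n z 1; rewrite cmod1 => /(_ _).
  set a := G n (z + 1); set b := G n z; set d := D (n, z).
  have := ler_cmodB (a - b) (a - b - d); have := ler_cmodB a b.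
  have -> : a - b - (a - b - d) = d by ring.
  move=> ? ? H; have : cmod a <= M z by apply: H; lra.
  by lra.
have lip n z h : cmod h <= 1 -> cmod (G n (z + h) - G n z) <= 6 * M z * cmod h.
  move=> h1; have := taylor n z h h1; have := DM n z.
  have := ler_cmodD (G n (z + h) - G n z - D (n, z) * h) (D (n, z) * h).
  rewrite subrK cmodM; have := cmod_ge0 h; have := M0 z.
  move=> a b c d e.
  have : 2 * M z * cmod h ^+ 2 <= 2 * M z * cmod h.
    by rewrite ler_wpM2l ?mulr_ge0// expr2 ler_piMr.
  have : cmod (D (n, z)) * cmod h <= 4 * M z * cmod h by rewrite ler_wpM2r.
  lra.
(* A single index serves finitely many points, so estimates comparing values at [z] and [z + h] pass
   from [G n] to [g]. *)
have gapprox (zs : seq C) e : 0 < e -> U [set n | forall z, z \in zs -> cmod (G n z - g z) <= e].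
  move=> e0; elim: zs => [|z zs IH]; first exact: filterE.
  apply: filterS (filterI (gP z e e0) IH) => n /= [H1 H2] t.
  by rewrite inE => /orP[/eqP->|/H2].
have glip z h : cmod h <= 1 -> cmod (g (z + h) - g z) <= 6 * M z * cmod h.
  move=> h1; apply/ler_addgt0Pr => e e0.
  have e20 : 0 < e / 2 by rewrite divr_gt0.
  have [n /= nP] := filter_ex (gapprox [:: z; z + h] _ e20).
  have := nP z; rewrite !inE eqxx => /(_ isT).
  have := nP (z + h); rewrite !inE eqxx orbT => /(_ isT).
  have := lip n z h h1.
  set A := G n (z + h); set E := G n z => H1 H2 H3.
  have -> : g (z + h) - g z = (A - E) + ((E - g z) - (A - g (z + h))) by ring.
  have := ler_cmodD (A - E) ((E - g z) - (A - g (z + h))).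
  have := ler_cmodB (E - g z) (A - g (z + h)).
  lra.
have gE : entire g.
  move=> z; apply/derivable_cdiff.
  have [|d dP] := @ultra_limit U (fun n => D (n, z)) (4 * M z) UU; first by move=> n; exact: DM.
  exists d.
  have gt h : cmod h <= 1 -> cmod (g (z + h) - g z - d * h) <= 2 * M z * cmod h ^+ 2.
    move=> h1; apply/ler_addgt0Pr => e e0.
    have e30 : 0 < e / 3 by rewrite divr_gt0.
    have [n /= [nP nD]] := filter_ex (filterI (gapprox [:: z; z + h] _ e30) (dP _ e30)).
    have := nP z; rewrite !inE eqxx => /(_ isT).
    have := nP (z + h); rewrite !inE eqxx orbT => /(_ isT).
    have := taylor n z h h1; move: nD.
    set A := G n (z + h); set E := G n z; set F := D (n, z) => H0 H1 H2 H3.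
    have -> : g (z + h) - g z - d * h =
        (A - E - F * h) + (((E - g z) - (A - g (z + h))) + (F - d) * h) by ring.
    have := ler_cmodD (A - E - F * h) (((E - g z) - (A - g (z + h))) + (F - d) * h).
    have := ler_cmodD ((E - g z) - (A - g (z + h))) ((F - d) * h).
    have := ler_cmodB (E - g z) (A - g (z + h)).
    have : cmod ((F - d) * h) <= e / 3.
      rewrite cmodM (le_trans _ H0)// ler_piMr ?cmod_ge0//.
    lra.
  move=> e e0; exists (Num.min 1 (e / (1 + 2 * M z))).
    by rewrite lt_min ltr01 divr_gt0// ltr_wpDr// mulr_ge0.
  move=> h; rewrite lt_min => /andP[/ltW h1].
  rewrite ltr_pdivlMr; last by rewrite ltr_wpDr// mulr_ge0.
  move=> he; apply: (le_trans (gt h h1)).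
  have := cmod_ge0 h; have := M0 z; nra.
have unif r e : 0 < e -> U [set n | forall z, cmod z <= r -> cmod (G n z - g z) <= e].
  move=> e0.
  have cK : compact (`[- r, r]%classic `*` `[- r, r]%classic : set (R * R)).
    by apply: compact_setX; exact: segment_compact.
  have := (compact_near_coveringP _).1 cK _ U (fun n u => cmod (G n (u.1 +i* u.2) - g (u.1 +i* u.2)) <= e) UF.
  move=> H; have : \near U, (`[- r, r]%classic `*` `[- r, r]%classic : set (R * R)) `<=`
     (fun u => cmod (G U (u.1 +i* u.2) - g (u.1 +i* u.2)) <= e).
    apply: H => -[x y] _ /=; set z := x +i* y.
    have e20 : 0 < e / 2 by rewrite divr_gt0.
    (* With [cmod h <= 2 * rho], the Lipschitz bounds of [G n] and [g] together cost [12 * M z *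
       cmod h <= 24 * M z * rho <= e / 2]. *)
    pose rho : R := Num.min (1 / 2) (e / (48 * (1 + M z))).
    have M1 : 0 < 1 + M z by have := M0 z; lra.
    have rho0 : 0 < rho.
      by rewrite lt_min; apply/andP; split; [lra|rewrite divr_gt0// mulr_gt0].
    have rho1 : rho <= 1 / 2 by rewrite ge_min lexx.
    have rhoM : rho * (48 * (1 + M z)) <= e.
      by rewrite -ler_pdivlMr ?mulr_gt0// ge_min lexx orbT.
    exists (ball (x, y) rho, [set n | cmod (G n z - g z) <= e / 2]).
      by split; [exact: nbhsx_ballx|exact: gP].
    move=> -[[u v] n] /= [[/= xu yv] nP].
    have -> : u +i* v = z + ((u - x) +i* (v - y)).
      by apply/eqP; rewrite eq_complex /=; apply/andP; split; apply/eqP; ring.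
    set h := (u - x) +i* (v - y).
    have hr : cmod h <= 2 * rho.
      have := ler_cmod_ReIm h; move: xu yv; rewrite /ball /= [`|x - u|]distrC [`|y - v|]distrC.
      lra.
    have h1 : cmod h <= 1 by lra.
    have := lip n z h h1; have := glip z h h1.
    set A := G n (z + h); set E := G n z => H1 H2.
    have -> : A - g (z + h) = (E - g z) + ((A - E) - (g (z + h) - g z)) by ring.
    have := ler_cmodD (E - g z) ((A - E) - (g (z + h) - g z)).
    have := ler_cmodB (A - E) (g (z + h) - g z).
    have := cmod_ge0 h; have := M0 z; nra.
  apply: filterS => n /= nP [x y] zr.
  have := ler_Re_cmod (x +i* y); have := ler_Im_cmod (x +i* y) => /= yr xr.
  by apply: (nP (x, y)); split => /=; rewrite in_itv /= -ler_norml; lra.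
(* [U] contains every tail, so an index beyond [N] can be chosen; feeding in the previous index
   makes [s] strictly increasing, while radius [m] and accuracy [1 / m.+1] improve together. *)
have /choice[F FP] (Nm : nat * nat) : exists n, (Nm.1 < n)%N /\
    forall z, cmod z <= Nm.2%:R -> cmod (G n z - g z) <= Nm.2.+1%:R^-1.
  have N0 : (0 : R) < Nm.2.+1%:R^-1 by rewrite invr_gt0.
  have UN : U [set n | (Nm.1 < n)%N] by apply: Uoo; exact: nbhs_infty_gt.
  by have [n /= [? ?]] := filter_ex (filterI UN (unif Nm.2%:R _ N0)); exists n.
pose s := fix s n := if n is n'.+1 then F (s n', n) else F (0%N, 0%N).
have sF m : exists N, s m = F (N, m) by case: m => [|m]; [exists 0%N|exists (s m)].
exists s, g; split => //.
  apply: homo_ltn; first exact: ltn_trans.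
  by move=> m /=; case: (FP (s m, m.+1)).
move=> r e e0.
pose N := (Num.truncn (Num.max r e^-1)).+1; exists N => m Nm z zr.
have Nr : Num.max r e^-1 < m%:R.
  by apply: lt_le_trans (truncnS_gt _) _; rewrite ler_nat.
move: Nr; rewrite gt_max => /andP[rm em].
have [K ->] := sF m; have [_] := FP (K, m).
move=> /(_ z)/= H; apply: (le_trans (H _)); first by lra.
rewrite invf_ple ?posrE//; apply: ltW; apply: lt_le_trans em _.
by rewrite ler_nat.
Qed.

End Montel.

(** * Fock norms *)

Section FockNorm.
Context {R : realType}.
Local Notation C := R[i].
Local Notation Re := (@complex.Re R).
Local Notation Im := (@complex.Im R).
Local Notation mu := (@lebesgue_measure R).
Implicit Types (f g : C -> C) (h z w d k : C).

Lemma integral_gaussian (c : R) : 0 < c ->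
  exists2 K : R, 0 <= K & (\int[mu]_x (expR (- (c * x ^+ 2)))%:E = K%:E)%E.
Proof.
(* The centred normal density of variance [1 / (2 c)] is a multiple of this Gaussian and has
   integral 1. *)
move=> c0; pose s : R := Num.sqrt (2 * c)^-1.
have s2 : s ^+ 2 = (2 * c)^-1 by rewrite sqr_sqrtr// invr_ge0 mulr_ge0// ltW.
have s0 : s != 0 by rewrite gt_eqF// sqrtr_gt0 invr_gt0 mulr_gt0.
have pk : 0 < normal_peak s by exact: normal_peak_gt0.
exists (normal_peak s)^-1; first by rewrite invr_ge0 ltW.
have mg : measurable_fun setT (fun x : R => (expR (- (c * x ^+ 2)))%:E).
  apply/measurable_EFinP; apply: measurableT_comp => //; apply: measurableT_comp => //.
  by apply: measurable_funM => //; exact: measurable_funX.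
have := @integral_normal_pdf R 0 s.
under eq_integral => x _.
  rewrite normal_pdfE// EFinM.
  have -> : normal_fun 0 s x = expR (- (c * x ^+ 2)).
    rewrite /normal_fun subr0 s2; congr expR; rewrite -mulr_natr.
    by field; rewrite gt_eqF.
  over.
rewrite ge0_integralZl//=; last by rewrite lee_fin ltW.
move=> H; have : ((normal_peak s)^-1%:E * ((normal_peak s)%:E * \int[mu]_x (expR (- (c * x ^+ 2)))%:E) = (normal_peak s)^-1%:E)%E.
  by rewrite H mule1.
by rewrite muleA -EFinM mulVf ?gt_eqF// mul1e.
Qed.

Lemma integral_gaussian2 (c : R) : 0 < c ->
  exists2 K : R, 0 <= K &
    (\int[(mu \x mu)%E]_u (expR (- (c * cmod (u.1 +i* u.2) ^+ 2)))%:E = K%:E)%E.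
Proof.
move=> c0; have [K K0 KE] := integral_gaussian c0; exists (K * K); first exact: mulr_ge0.
pose W (u : R * R) := expR (- (c * cmod (u.1 +i* u.2) ^+ 2)).
have idc z : ccont (fun w => w) z by exact/cderivable_ccont/cderivable_id.
have mW : measurable_fun setT W.
  apply: measurableT_comp => //; apply: measurableT_comp => //.
  by apply: measurable_funM => //; apply: measurable_funX; exact: (measurable_cmod idc).
have mWe : measurable_fun setT (EFin \o W) by exact/measurable_EFinP.
have W0 u : (0 <= (EFin \o W) u)%E by rewrite lee_fin expR_ge0.
have mg : measurable_fun setT (fun x : R => (expR (- (c * x ^+ 2)))%:E).
  apply/measurable_EFinP; apply: measurableT_comp => //; apply: measurableT_comp => //.
  by apply: measurable_funM => //; exact: measurable_funX.
apply: (eq_trans (fubini_tonelli1 (m1 := mu) (m2 := mu) (EFin \o W) mWe W0)).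
rewrite /fubini_F.
under eq_integral => x _.
  under eq_integral => y _.
    rewrite /= /W sqr_cmod /= mulrDr opprD expRD EFinM; over.
  rewrite ge0_integralZl//=.
  rewrite KE muleC; over.
by rewrite ge0_integralZl//= KE.
Qed.

(** [K] depends neither on [f] nor on [e]: the lemma yields membership in the space for fixed [e],
    and norm convergence when [e] tends to 0. *)
Lemma fock_norm_le (alpha : R) (p : \bar R) (delta : R) :
  0 < alpha -> (1 <= p)%E -> 0 < delta ->
  exists2 K : R, 0 <= K & forall f (e : R), (forall z, ccont f z) -> 0 <= e ->
    (forall z, cmod (f z) * expR (- (alpha / 2 * cmod z ^+ 2)) <=
      e * expR (- (delta * cmod z ^+ 2))) ->
    (fock_norm alpha p f <= (e * K)%:E)%E.
Proof.
move=> al0; case: p => [r||]//=; last first.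
  move=> _ d0; exists 1 => // f e _ e0 H; apply: ge_ereal_sup => _ [z _ <-].
  rewrite lee_fin mulr1; apply: (le_trans (H z)); rewrite ler_piMr//.
  by rewrite -expR0 ler_expR oppr_le0 mulr_ge0 ?sqr_ge0// ltW.
rewrite lee_fin => r1 d0; have r0 : 0 < r by lra.
have [K K0 KE] := @integral_gaussian2 (r * delta) (mulr_gt0 r0 d0).
have c0 : 0 <= alpha * r / (2 * pi).
  by rewrite divr_ge0// mulr_ge0 ?pi_ge0// ltW.
exists ((alpha * r / (2 * pi) * K) `^ r^-1); first exact: powR_ge0.
move=> f e fc e0 H.
have er : (e `^ r) `^ r^-1 = e by rewrite -powRrM mulfV ?gt_eqF// powRr1.
rewrite -er -powRM ?powR_ge0 ?(mulr_ge0 c0 K0)//.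
rewrite -poweR_EFin; apply: gt0_ler_poweR.
- by rewrite invr_ge0 ltW.
- rewrite in_itv /= leey andbT mule_ge0//; apply: integral_ge0 => u _.
  by rewrite lee_fin mulr_ge0 ?powR_ge0 ?expR_ge0.
- by rewrite in_itv /= leey andbT lee_fin mulr_ge0 ?powR_ge0// mulr_ge0.
rewrite [X in (_ <= X%:E)%E]mulrCA [X in (_ <= X)%E]EFinM; apply: lee_wpmul2l; first by rewrite lee_fin.
have m1 : measurable_fun setT (EFin \o fock_weight alpha r f).
  by apply/measurable_EFinP; exact: measurable_fock_weight.
have idc z : ccont (fun w => w) z by exact/cderivable_ccont/cderivable_id.
have m2 : measurable_fun setT (fun u : R * R => (expR (- (r * delta * cmod (u.1 +i* u.2) ^+ 2)))%:E).
  apply/measurable_EFinP; apply: measurableT_comp => //; apply: measurableT_comp => //.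
  by apply: measurable_funM => //; apply: measurable_funX; exact: (measurable_cmod idc).
rewrite EFinM -KE -ge0_integralZl//; last by rewrite lee_fin powR_ge0.
rewrite /area_integral; apply: ge0_le_integral => //.
- by move=> u _; rewrite lee_fin mulr_ge0 ?powR_ge0 ?expR_ge0.
- by apply: measurable_funeM.
move=> [x y] _ /=; set z := x +i* y; rewrite -EFinM lee_fin.
have -> : expR (- (alpha * r / 2 * cmod z ^+ 2)) = expR (- (alpha / 2 * cmod z ^+ 2)) `^ r.
  by rewrite /powR gt_eqF ?expR_gt0// expRK; congr expR; ring.
have -> : expR (- (r * delta * cmod z ^+ 2)) = expR (- (delta * cmod z ^+ 2)) `^ r.
  by rewrite /powR gt_eqF ?expR_gt0// expRK; congr expR; ring.
rewrite -!powRM ?cmod_ge0 ?expR_ge0//; apply: ge0_ler_powR; rewrite ?nnegrE.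
- exact: ltW.
- by rewrite mulr_ge0 ?cmod_ge0 ?expR_ge0.
- by rewrite mulr_ge0 ?expR_ge0.
- exact: H.
Qed.

(** [A] depends on [f] only through the norm bound, so norm-bounded families are locally bounded.
    The shift by 3 comes from finite [p]. *)
Lemma fock_growth (alpha : R) (p : \bar R) (M : R) : 0 < alpha -> (1 <= p)%E ->
  exists2 A : R, 0 <= A & forall f, fock alpha p f -> (fock_norm alpha p f <= M%:E)%E ->
    forall z, cmod (f z) <= A * expR (alpha / 2 * (cmod z + 3) ^+ 2).
Proof.
move=> al0; case: p => [r||]//=; last first.
  move=> _; exists `|M| => // f _ /ereal_supP fM z.
  have := fM _ (ex_intro2 _ _ z I erefl); rewrite lee_fin => H.
  apply: (@le_trans _ _ (M * expR (alpha / 2 * cmod z ^+ 2))).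
    by rewrite -ler_pdivrMr ?expR_gt0// -expRN.
  apply: ler_pM; rewrite ?expR_ge0 ?ler_norm//.
    by apply: le_trans H; rewrite mulr_ge0 ?cmod_ge0 ?expR_ge0.
  rewrite ler_expR ler_wpM2l ?divr_ge0 ?(ltW al0)//.
  by have := cmod_ge0 z; nra.
rewrite lee_fin => r1; have r0 : 0 < r by lra.
have c0 : 0 < alpha * r / (2 * pi) by rewrite divr_gt0 ?mulr_gt0 ?pi_gt0.
set c := alpha * r / (2 * pi) in c0 *.
exists (`|M| `^ r / c + 5).
  by rewrite addr_ge0// divr_ge0 ?powR_ge0// ltW.
move=> f [fE _] fM z.
have I0 : (0 <= \int[(mu \x mu)%E]_u (fock_weight alpha r f u)%:E)%E.
  by apply: integral_ge0 => u _; rewrite lee_fin fock_weight_ge0.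
case: z => x y; apply: (growth_of_integral (r := r)) => //.
rewrite mulrC EFinM -lee_pdivrMl//.
have : (((c%:E * \int[(mu \x mu)%E]_u (fock_weight alpha r f u)%:E) `^ r^-1) `^ r <= M%:E `^ r)%E.
  apply: (gt0_ler_poweR _ _ _ fM); rewrite ?in_itv /= ?leey ?andbT ?poweR_ge0 ?(ltW r0)//.
  by apply: (le_trans _ fM); exact: poweR_ge0.
rewrite -poweRrM mulVf ?gt_eqF// poweRe1; last by rewrite mule_ge0// lee_fin ltW.
have M0 : 0 <= M by rewrite -lee_fin; apply: (le_trans _ fM); exact: poweR_ge0.
by rewrite poweR_EFin ger0_norm// invrK.
by rewrite invr_gt0.
Qed.

End FockNorm.

(** * The symbol of the operator *)

Section GaussianWeights.
Context {R : realType}.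
Local Notation C := R[i].
Local Notation Re := (@complex.Re R).
Local Notation Im := (@complex.Im R).
Implicit Types (f g : C -> C) (h z w d k : C).

Lemma exists_sqr_arg z : exists2 w, cmod w = 1 & Re (z * w ^+ 2) = cmod z.
Proof.
have [c c1 cz] := norm_Im_arg z; exists (sqrtc (- 'i * c)).
  apply/eqP; rewrite -(@eqrXn2 _ 2) ?cmod_ge0// -cmodX sqr_sqrtc.
  by rewrite cmodM cmodN cmodi c1 mulr1 expr1n.
rewrite sqr_sqrtc -cz; case: (z) (c) => [? ?] [? ?] /=; ring.
Qed.

Lemma fock_bounded alpha (p : \bar R) f : fock alpha p f ->
  exists M : R, (fock_norm alpha p f <= M%:E)%E.
Proof.
case=> _; case: (fock_norm alpha p f) => [M _|//|_]; first by exists M.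
by exists 0; rewrite leNye.
Qed.

Lemma fock_gaussian alpha (p : \bar R) (c : C) : (1 <= p)%E -> 0 < alpha ->
  2 * cmod c < alpha -> fock alpha p (fun z => cexp (c * z ^+ 2)).
Proof.
move=> p1 al0 ca.
have -> : (fun z => cexp (c * z ^+ 2)) = (fun z => cexp (0 + 0 * z + c * z ^+ 2)).
  by apply/funext => z; rewrite mul0r !add0r.
have fE := @entire_cexp_quadratic R 0 0 c.
have d0 : 0 < alpha / 2 - cmod c by lra.
have [K K0 KP] := fock_norm_le al0 p1 d0.
split => //; apply: le_lt_trans (KP _ 1 (entire_ccont fE) ler01 _) _; last exact: ltry.
move=> z; rewrite mul1r mul0r !add0r cmod_cexp -expRD ler_expR.
have := ler_Re_cmod (c * z ^+ 2); rewrite cmodM cmodX ler_norml; lra.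
Qed.

Lemma quadratic_coef_le (alpha : R) (p : \bar R) (a lambda a0 a1 a2 : C) (phi psi : C -> C) :
  0 < alpha -> (1 <= p)%E -> 0 < cmod lambda < 1 ->
  (forall z, phi z = a + lambda * z) ->
  (forall z, psi z = cexp (a0 + a1 * z + a2 * z ^+ 2)) ->
  (forall f, fock alpha p f -> fock alpha p (weighted_composition psi phi f)) ->
  2 * cmod a2 <= alpha * (1 - cmod lambda ^+ 2).
Proof.
move=> al0 p1 /andP[l0 l1] phiE psiE W; rewrite leNgt; apply/negP => H.
set A := cmod a2 in H *; set l := cmod lambda ^+ 2 in H *.
have l1' : l < 1 by rewrite expr_lt1// ltW.
have l0' : 0 < l by rewrite exprn_gt0.
pose eta := A - alpha / 2 * (1 - l).
have eta0 : 0 < eta by rewrite /eta; lra.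
(* [s < alpha / 2] puts the Gaussian in the space, at the price of [del * l] in the growth rate:
   [gam = eta - del * l], still positive since [del <= eta / 2] and [l < 1]. *)
pose del := Num.min (alpha / 2) (eta / 2).
have del0 : 0 < del by rewrite lt_min !divr_gt0.
have dela : del <= alpha / 2 by rewrite ge_min lexx.
have dele : del <= eta / 2 by rewrite ge_min lexx orbT.
pose s := alpha / 2 - del.
have s0 : 0 <= s by rewrite /s; lra.
pose gam := A + s * l - alpha / 2.
have gam0 : 0 < gam by rewrite /gam /s; move: dele; rewrite /eta; nra.
(* Along the ray through w both a2 z^2 and c (lambda z)^2 are real and nonnegative,
   so that the two quadratic growth rates add up. *)
have [w w1 wA] := exists_sqr_arg a2.
pose v := (lambda * w) ^+ 2.
have cv : cmod v = l by rewrite /v cmodX cmodM w1 mulr1.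
pose c := s%:C * ((v^*)%C / l%:C).
have cJ (z : C) : cmod (z^*)%C = cmod z by rewrite !cmodE; case: z => x y /=; rewrite sqrrN.
have cs : cmod c = s.
  rewrite /c !cmodM cmodV cJ cv !cmod_real !ger0_norm ?(ltW l0')//.
  by rewrite divff ?mulr1// gt_eqF.
have cvE : Re (c * v) = s * l.
  have -> : c * v = (s%:C / l%:C) * (v * (v^*)%C) by rewrite /c; ring.
  rewrite -sqr_normc norm_cmod cv -rmorphXn -fmorphV -!rmorphM /= expr2 mulrA divfK// gt_eqF//.
clearbody c.
have fF : fock alpha p (fun z => cexp (c * z ^+ 2)).
  by apply: fock_gaussian => //; rewrite cs /s; lra.
have WF := W _ fF; have [M MP] := fock_bounded WF.
have [A0 A00 A0P] := fock_growth M al0 p1.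
have {}A0P := A0P _ WF MP.
(* Bounds for the linear and constant terms in [t]; [3 * alpha] and [9 * alpha / 2] come from
   expanding [alpha / 2 * (t + 3) ^+ 2]. *)
pose B1 := cmod a1 + 2 * s * cmod a * cmod lambda + 3 * alpha.
pose B0 := cmod a0 + s * cmod a ^+ 2 + 9 * alpha / 2.
have B10 : 0 <= B1 by rewrite !addr_ge0 ?mulr_ge0 ?cmod_ge0 ?(ltW al0).
have B00 : 0 <= B0 by rewrite !addr_ge0 ?mulr_ge0 ?sqr_ge0 ?cmod_ge0 ?(ltW al0).
have key t : 0 <= t -> expR (gam * t ^+ 2 - B1 * t - B0) <= A0.
  move=> t0; have := A0P (t%:C * w).
  rewrite /weighted_composition psiE phiE cmodM !cmod_cexp -expRD.
  rewrite [cmod (_ * w)]cmodM w1 mulr1 cmod_real ger0_norm//.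
  rewrite -ler_pdivrMr ?expR_gt0// -expRN -expRD => H1; apply: (le_trans _ H1).
  rewrite ler_expR.
  set z := t%:C * w.
  have -> : c * (a + lambda * z) ^+ 2 = c * a ^+ 2 + (t%:C * (2%:C * c * a * lambda * w) + (t ^+ 2)%:C * (c * v)).
    by rewrite /z /v rmorphXn /= (_ : 2%:C = 2 :> C); [ring|exact: rmorph_nat].
  have -> : a2 * z ^+ 2 = (t ^+ 2)%:C * (a2 * w ^+ 2).
    by rewrite /z rmorphXn /=; ring.
  have -> : a1 * z = t%:C * (a1 * w) by rewrite /z; ring.
  have ReZ (x : R) (u : C) : Re (x%:C * u) = x * Re u by rewrite cReM /= mul0r subr0.
  rewrite !cReD !ReZ wA cvE.
  have hb (u : C) (B : R) : cmod u = B -> - B <= Re u.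
    by move=> <-; have := ler_Re_cmod u; rewrite ler_norml => /andP[].
  have h0 := hb a0 _ erefl.
  have h1 := hb (a1 * w) (cmod a1); rewrite cmodM w1 mulr1 in h1.
  have h2 := hb (c * a ^+ 2) (s * cmod a ^+ 2); rewrite cmodM cmodX cs in h2.
  have h3 := hb (2%:C * c * a * lambda * w) (2 * s * cmod a * cmod lambda).
  rewrite !cmodM cs w1 mulr1 cmod_real ger0_norm// in h3.
  have {}h1 := ler_wpM2l t0 (h1 erefl).
  have {}h3 := ler_wpM2l t0 (h3 erefl).
  have {}h2 := h2 erefl.
  rewrite /gam /B1 /B0 -/A; move: h0 h1 h2 h3.
  lra.
(* The exponent becomes [(gam + B0 + A0) * t - B0 >= gam + A0], so its exponential exceeds [A0]. *)
pose t := 1 + (B1 + B0 + A0) / gam.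
clearbody B0 B1.
have t1 : 1 <= t by rewrite lerDl divr_ge0 ?(ltW gam0)//; lra.
have := key t (le_trans ler01 t1).
have E : gam * t = gam + B1 + B0 + A0 by rewrite /t; field; rewrite gt_eqF.
apply/negP; rewrite -ltNge; apply: lt_le_trans (expR_ge1Dx _).
have -> : gam * t ^+ 2 - B1 * t - B0 = (gam * t) * t - B1 * t - B0 by ring.
rewrite E; nra.
Qed.

(** The squares of the two sides differ by [4 * Im z ^+ 2]. *)
Lemma cmod_sqr_add1_lt z : Im z != 0 -> cmod (1 + z ^+ 2) < 1 + cmod z ^+ 2.
Proof.
case: z => x y /= y0.
rewrite -(ltr_pXn2r (_ : 0 < 2)%N) ?nnegrE ?cmod_ge0 ?addr_ge0 ?sqr_ge0//.
have y20 : 0 < y ^+ 2 by rewrite exprn_even_gt0.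
rewrite !sqr_cmod !cReD !cImD !(expr2 (x +i* y)) cReM cImM /=; lra.
Qed.

Lemma iterated_weight_decay (alpha : R) (a lambda a0 a1 a2 : C) (phi psi : C -> C) :
  0 < alpha -> cmod lambda < 1 -> Im lambda != 0 ->
  (forall z, phi z = a + lambda * z) ->
  (forall z, psi z = cexp (a0 + a1 * z + a2 * z ^+ 2)) ->
  2 * cmod a2 <= alpha * (1 - cmod lambda ^+ 2) ->
  exists2 delta, 0 < delta & exists2 D : R, 0 <= D & forall z,
    cmod (psi z * psi (phi z)) * expR (alpha / 2 * (cmod (phi (phi z)) + 3) ^+ 2) <=
      D * expR (alpha / 2 * cmod z ^+ 2 - delta * cmod z ^+ 2).
Proof.
move=> al0 l1 l0 phiE psiE HA.
set A := cmod a2 in HA *; set l := cmod lambda ^+ 2 in HA *.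
have l1' : l < 1 by rewrite expr_lt1// cmod_ge0.
have l0' : 0 <= l by rewrite sqr_ge0.
pose m := cmod (1 + lambda ^+ 2).
have ml : m < 1 + l by exact: cmod_sqr_add1_lt.
have m0 : 0 <= m by exact: cmod_ge0.
have A0 : 0 <= A by exact: cmod_ge0.
(* The quadratic coefficient is at most [alpha / 2 * ((1 - l) * m + l ^+ 2)], and [kap] is exactly
   what it lacks to [alpha / 2]. One half of [kap] becomes [delta], the other absorbs the linear
   term. *)
pose kap := alpha / 2 * ((1 - l) * (1 + l - m)).
have kap0 : 0 < kap by rewrite !mulr_gt0// ?invr_gt0//; lra.
pose b0 := 2 * a0 + a1 * a + a2 * a ^+ 2.
pose b1 := a1 + a1 * lambda + 2 * a2 * a * lambda.
pose c0 := cmod (a + lambda * a).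
have c00 : 0 <= c0 by exact: cmod_ge0.
pose D0 := cmod b0 + alpha / 2 * (c0 + 3) ^+ 2.
pose D1 := cmod b1 + alpha * (c0 + 3) * l.
exists (kap / 2); first by rewrite divr_gt0.
exists (expR (D0 + D1 ^+ 2 / (2 * kap))); first exact: expR_ge0.
move=> z; set r := cmod z; have r0 : 0 <= r by exact: cmod_ge0.
rewrite !psiE -cexpD cmod_cexp -!expRD ler_expR.
have -> : a0 + a1 * z + a2 * z ^+ 2 + (a0 + a1 * phi z + a2 * phi z ^+ 2) =
    b0 + (b1 * z + a2 * (1 + lambda ^+ 2) * z ^+ 2).
  by rewrite phiE /b0 /b1; ring.
have P1 : Re (b0 + (b1 * z + a2 * (1 + lambda ^+ 2) * z ^+ 2)) <=
    cmod b0 + (cmod b1 * r + A * m * r ^+ 2).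
  apply: le_trans (ler_norm _) _; apply: le_trans (ler_Re_cmod _) _.
  apply: le_trans (ler_cmodD _ _) _; rewrite lerD2l.
  by apply: le_trans (ler_cmodD _ _) _; rewrite (cmodM b1) (cmodM (a2 * _)) (cmodM a2) cmodX.
have P2 : cmod (phi (phi z)) <= c0 + l * r.
  rewrite !phiE mulrDr addrA; apply: le_trans (ler_cmodD _ _) _.
  by rewrite mulrA -expr2 cmodM cmodX.
have P3 : alpha / 2 * (cmod (phi (phi z)) + 3) ^+ 2 <= alpha / 2 * (c0 + l * r + 3) ^+ 2.
  have lr0 : 0 <= l * r by exact: mulr_ge0.
  have p0 := cmod_ge0 (phi (phi z)).
  rewrite ler_wpM2l ?divr_ge0 ?(ltW al0)// ler_pXn2r ?nnegrE ?lerD2r//; lra.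
have P4 : A * m * r ^+ 2 <= alpha / 2 * (1 - l) * m * r ^+ 2.
  by rewrite !ler_wpM2r ?sqr_ge0//; lra.
(* Young's inequality, from the square of [r - D1 / kap]. *)
have P5 : D1 * r <= kap / 2 * r ^+ 2 + D1 ^+ 2 / (2 * kap).
  have -> : D1 ^+ 2 / (2 * kap) = (D1 / kap) ^+ 2 * kap / 2 by field; rewrite gt_eqF.
  have -> : D1 * r = kap * (D1 / kap) * r by field; rewrite gt_eqF.
  have := mulr_ge0 (ltW kap0) (sqr_ge0 (r - D1 / kap)).
  lra.
move: P1 P3 P4 P5; rewrite /D0 /D1 /kap; lra.
Qed.

End GaussianWeights.

(** * Norm convergence and compactness *)

Section Compactness.
Context {R : realType}.
Local Notation C := R[i].
Local Notation Re := (@complex.Re R).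
Local Notation Im := (@complex.Im R).
Implicit Types (f g : C -> C) (h z w d k : C).

Lemma fock_norm_ge0 alpha (p : \bar R) f : (0 <= fock_norm alpha p f)%E.
Proof.
case: p => [r||] //=; first exact: poweR_ge0.
apply: le_trans (ereal_sup_ubound _); last by exists 0.
by rewrite lee_fin mulr_ge0 ?cmod_ge0 ?expR_ge0.
Qed.

(* Gaussian domination plus locally uniform convergence gives domination by a
   small multiple of a wider Gaussian, hence norm convergence for all [p] at
   once. *)
Lemma fock_cvg_locally_uniform (alpha : R) (p : \bar R) (delta D : R) (F : nat -> C -> C) :
  0 < alpha -> (1 <= p)%E -> 0 < delta -> 0 <= D -> (forall n z, ccont (F n) z) ->
  (forall n z, cmod (F n z) * expR (- (alpha / 2 * cmod z ^+ 2)) <=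
    D * expR (- (delta * cmod z ^+ 2))) ->
  (forall r e : R, 0 < e -> exists N, forall n, (N <= n)%N ->
    forall z, cmod z <= r -> cmod (F n z) <= e) ->
  fock_norm alpha p (F n) @[n --> \oo] --> 0%E.
Proof.
move=> al0 p1 d0 D0 Fc FD FU.
have d20 : 0 < delta / 2 by rewrite divr_gt0.
have [K K0 KP] := fock_norm_le al0 p1 d20.
have small e : 0 < e -> \forall n \near \oo, (fock_norm alpha p (F n) <= (e * K)%:E)%E.
  move=> e0.
  (* Since [expR x >= 1 + x] and [r <= r ^+ 2], this radius gives
     [D <= e * expR (delta / 2 * r ^+ 2)]. *)
  pose r := Num.max 1 (2 * D / (delta * e)).
  have r1 : 1 <= r by rewrite le_max lexx.
  have rD : 2 * D <= r * (delta * e).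
    by rewrite -ler_pdivrMr ?mulr_gt0// le_max lexx orbT.
  have Dr : D * expR (- (delta / 2 * r ^+ 2)) <= e.
    rewrite expRN ler_pdivrMr ?expR_gt0//.
    have : 1 + delta / 2 * r ^+ 2 <= expR (delta / 2 * r ^+ 2) by exact: expR_ge1Dx.
    move=> /(ler_wpM2l (ltW e0)); apply: le_trans.
    have : r * (delta * e) <= r * (r * (delta * e)).
      by rewrite ler_peMl// !mulr_ge0 ?(ltW d0) ?(ltW e0)//; lra.
    by have := ltW e0; nra.
  (* The accuracy is the least value of [e * expR (- (delta / 2 * cmod z ^+ 2))] on the disc, so the
     wider Gaussian dominates there too. *)
  have [N NP] := FU r (e * expR (- (delta / 2 * r ^+ 2))) (mulr_gt0 e0 (expR_gt0 _)).
  exists N => // n /= Nn; apply: KP; [exact: Fc|exact: ltW|move=> z].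
  have [zr|/ltW rz] := leP (cmod z) r.
    apply: (@le_trans _ _ (cmod (F n z))).
      rewrite ler_piMr ?cmod_ge0// -expR0 ler_expR oppr_le0.
      by rewrite mulr_ge0 ?sqr_ge0// divr_ge0// ltW.
    apply: le_trans (NP n Nn z zr) _; rewrite ler_wpM2l ?(ltW e0)// ler_expR lerN2.
    by rewrite ler_wpM2l ?(ltW d20)// ler_pXn2r ?nnegrE ?cmod_ge0//; lra.
  apply: le_trans (FD n z) _.
  have -> : - (delta * cmod z ^+ 2) = - (delta / 2 * cmod z ^+ 2) + - (delta / 2 * cmod z ^+ 2).
    by field.
  rewrite expRD mulrA ler_wpM2r ?expR_ge0//.
  apply: le_trans Dr; rewrite ler_wpM2l// ler_expR lerN2 ler_wpM2l ?(ltW d20)//.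
  by rewrite ler_pXn2r ?nnegrE ?cmod_ge0//; lra.
apply/fine_cvgP; split.
  apply: filterS (small 1 ltr01) => n nP.
  rewrite fin_numElt (lt_le_trans _ (fock_norm_ge0 _ _ _)) ?ltNyr//=.
  by rewrite (le_lt_trans nP) ?ltry.
apply/cvgrPdist_le => e e0.
have eK : 0 < e / (1 + K) by rewrite divr_gt0//; lra.
apply: filterS (small _ eK) => n nP /=; rewrite sub0r normrN.
have n0 := fock_norm_ge0 alpha p (F n).
rewrite ger0_norm ?fine_ge0//.
have : fine (fock_norm alpha p (F n)) <= e / (1 + K) * K.
  rewrite -lee_fin fineK// fin_numElt (lt_le_trans _ n0) ?ltNyr//=.
  by rewrite (le_lt_trans nP) ?ltry.
move=> /le_trans; apply; rewrite mulrAC ler_pdivrMr; last lra.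
by rewrite ler_wpM2l ?(ltW e0)//; lra.
Qed.

End Compactness.

Local Close Scope classical_set_scope.

Theorem theorem4p2 (R : realType) (alpha : R) (p : \bar R)
    (a lambda a0 a1 a2 : R[i]) (phi psi : R[i] -> R[i])
    (halpha : 0 < alpha) (hp : (1 <= p)%E)
    (hlambda : `|lambda| < 1) (hlambda_nonreal : lambda \isn't Num.real)
    (hphi : forall z, phi z = a + lambda * z)
    (hpsi : forall z, psi z = cexp (a0 + a1 * z + a2 * z ^+ 2))
    (hbounded : bounded_operator_on alpha p (weighted_composition psi phi)) :
  weighted_composition_operator_on alpha p
    (weighted_composition psi phi \o weighted_composition psi phi) /\
  compact_operator_on alpha p
    (weighted_composition psi phi \o weighted_composition psi phi).
Proof.
have [[W _] _] := hbounded; set T := weighted_composition psi phi.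
have l1 : cmod lambda < 1 by rewrite -ltcR -norm_cmod.
have l0 : complex.Im lambda != 0.
  by move: hlambda_nonreal; case: (lambda) => x y; rewrite complex_real.
have lpos : 0 < cmod lambda.
  by rewrite cmod_gt0; apply: contra l0 => /eqP->.
have A2 := @quadratic_coef_le _ alpha p a lambda a0 a1 a2 phi psi halpha hp.
have {}A2 : 2 * cmod a2 <= alpha * (1 - cmod lambda ^+ 2).
  by apply: A2 => //; rewrite lpos.
split.
  exists (fun z => psi z * psi (phi z)), (fun z => phi (phi z)); split.
  - have -> : (fun z => psi z * psi (phi z)) = (fun z => cexp (
        (2 * a0 + a1 * a + a2 * a ^+ 2) + (a1 + a1 * lambda + 2 * a2 * a * lambda) * z +
        a2 * (1 + lambda ^+ 2) * z ^+ 2)).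
      by apply/funext => z; rewrite !hpsi -cexpD hphi; congr cexp; ring.
    exact: entire_cexp_quadratic.
  - have -> : (fun z => phi (phi z)) = (fun z => (a + lambda * a) + lambda ^+ 2 * z + 0 * z ^+ 2).
      by apply/funext => z; rewrite !hphi; ring.
    exact: entire_quadratic.
  - by exists 0; rewrite -cmod_gt0 !hpsi cmodM !cmod_cexp mulr_gt0 ?expR_gt0.
  - by move=> f _; apply/funext => z; rewrite /= /T /weighted_composition mulrA.
split.
  split=> [f fF|c f g _ _]; first exact/W/W.
  by apply/funext => z; rewrite /= /T /weighted_composition; ring.
move=> f fF [M fM].
have [delta d0 [D D0 DP]] := iterated_weight_decay halpha l1 l0 hphi hpsi A2.
have [A A0 AP] := fock_growth M halpha hp.
pose G n := (T \o T) (f n).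
have GE n : entire (G n) by have [] := W _ (W _ (fF n)).
have Gbnd n z : cmod (G n z) <= A * D * expR (alpha / 2 * cmod z ^+ 2 - delta * cmod z ^+ 2).
  rewrite /G /= /T /weighted_composition mulrA cmodM.
  apply: (@le_trans _ _ (cmod (psi z * psi (phi z)) *
    (A * expR (alpha / 2 * (cmod (phi (phi z)) + 3) ^+ 2)))).
    by rewrite ler_wpM2l ?cmod_ge0//; exact: (AP _ (fF n) (fM n)).
  by rewrite mulrCA -[leRHS]mulrA ler_wpM2l//; exact: DP.
have AD0 : 0 <= A * D by exact: mulr_ge0.
have [|s [g [sI gE gU]]] := @montel _ G (fun r => A * D * expR (alpha / 2 * r ^+ 2)) GE.
  move=> n z r zr; apply: le_trans (Gbnd n z) _; rewrite ler_wpM2l// ler_expR.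
  have z0 := cmod_ge0 z.
  have : cmod z ^+ 2 <= r ^+ 2 by rewrite ler_pXn2r ?nnegrE//; lra.
  move=> /(ler_wpM2l (ltW (divr_gt0 halpha (ltr0n R 2)))).
  by have := mulr_ge0 (ltW d0) (sqr_ge0 (cmod z)); lra.
(* The majorant passes to the limit: it puts [g] in the space and, doubled, dominates the
   differences [G (s n) z - g z]. *)
have gbnd z : cmod (g z) <= A * D * expR (alpha / 2 * cmod z ^+ 2 - delta * cmod z ^+ 2).
  apply/ler_addgt0Pr => e e0; have [N NP] := gU (cmod z) e e0.
  have := NP N (leqnn N) z (lexx _); have := Gbnd (s N) z; rewrite cmodB.
  by have := ler_cmodBB (g z) (G (s N) z); lra.
have wbnd f1 z E : cmod (f1 z) <= E * expR (alpha / 2 * cmod z ^+ 2 - delta * cmod z ^+ 2) ->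
    cmod (f1 z) * expR (- (alpha / 2 * cmod z ^+ 2)) <= E * expR (- (delta * cmod z ^+ 2)).
  move=> H; rewrite [X in _ * X]expRN ler_pdivrMr ?expR_gt0// -[leRHS]mulrA -expRD.
  by rewrite [- _ + _]addrC.
exists s, g; split => //.
  split => //; have [K K0 KP] := fock_norm_le halpha hp d0.
  apply: le_lt_trans (KP g (A * D) (entire_ccont gE) AD0 _) _; last exact: ltry.
  by move=> z; exact: wbnd.
apply: (@fock_cvg_locally_uniform _ _ _ delta (2 * (A * D))) => //.
- by rewrite mulr_ge0.
- by move=> n z; apply/cderivable_ccont/cderivableB; [exact: GE|exact: gE].
- move=> n z; apply: (wbnd (fun z => G (s n) z - g z)).
  apply: le_trans (ler_cmodB _ _) _.
  by have := Gbnd (s n) z; have := gbnd z; lra.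
Qed.
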